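(* Let $a\in\mathbb{R}$, $k\in L^1([0,\infty);\mathbb{R})\cap C([0,\infty);\mathbb{R})$ and $\sigma\in\mathbb{R}\setminus\{0\}$. Let $r$ be the resolvent of $k$ (see context) and suppose $r\in L^2([0,\infty);\mathbb{R})$. Let $X$ be the unique continuous solution of $$dX(t)=\Big(aX(t)+\int_0^t k(t-s)X(s)\,ds\Big)dt+\sigma\,dB(t),\quad t\ge 0,\qquad X(0)=X_0,$$ where $B$ is a standard one-dimensional Brownian motion and $X_0$ is an $\mathcal{F}_0$-measurable real random variable with $\mathbb{E}|X_0|^2<\infty$, independent of $B$. Then for every $t\ge 0$ the limit $$c(t):=\lim_{s\to\infty}\operatorname{Cov}(X(s),X(s+t))$$ exists and equals $\sigma^2\int_0^\infty r(s)r(s+t)\,ds$.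
   Context: The resolvent (fundamental solution) $r:[0,\infty)\to\mathbb{R}$ is the unique continuous solution of $r'(t)=ar(t)+\int_0^t k(t-s)r(s)\,ds$ for $t\ge0$, $r(0)=1$. The underlying probability space $(\Omega,\mathcal{F},\mathbb{P})$ carries a filtration $(\mathcal{F}_t)_{t\ge0}$ to which $B$ is adapted. *)

(* Defs.v *)
From HB Require Import structures.
From mathcomp Require Import all_boot all_order all_algebra.
From mathcomp Require Import all_classical all_reals all_analysis.
Set Implicit Arguments. Unset Strict Implicit. Unset Printing Implicit Defensive.
Import Order.TTheory GRing.Theory Num.Theory.
Import numFieldNormedType.Exports.
Local Open Scope classical_set_scope.
Local Open Scope ring_scope.

Section defs.
Context {R : realType} {d : measure_display} {T : measurableType d}.
Variable P : probability T R.

Definition filtration (F : R -> set (set T)) : Prop :=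
  (forall t, 0 <= t -> sigma_algebra setT (F t)) /\
  (forall t, 0 <= t -> F t `<=` measurable) /\
  (forall s t, 0 <= s -> s <= t -> F s `<=` F t).

Definition measurable_wrt (G : set (set T)) (Y : T -> R) : Prop :=
  forall A : set R, measurable A -> G (Y @^-1` A).

Definition indep_sigma_rv (G : set (set T)) (Y : T -> R) : Prop :=
  forall (E : set T) (A : set R), G E -> measurable A ->
    P (E `&` Y @^-1` A) = (P E * P (Y @^-1` A))%E.

(* the random variable Y is independent of the process Z = (Z t)_{t >= 0}
   (i.e. of the sigma-algebra generated by the process) *)
Definition indep_rv_process (Y : T -> R) (Z : R -> T -> R) : Prop :=
  forall (n : nat) (ts : 'I_n -> R) (C : 'I_n -> set R) (A : set R),
    (forall i, 0 <= ts i) -> (forall i, measurable (C i)) -> measurable A ->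
    P (Y @^-1` A `&` \bigcap_(i in [set: 'I_n]) (Z (ts i) @^-1` C i)) =
    (P (Y @^-1` A) * P (\bigcap_(i in [set: 'I_n]) (Z (ts i) @^-1` C i)))%E.

Definition brownian_motion (F : R -> set (set T)) (B : R -> T -> R) : Prop :=
  [/\ forall t, 0 <= t -> measurable_wrt (F t) (B t),
      {ae P, forall w, B 0 w = 0},
      {ae P, forall w, {within `[0, +oo[%classic, continuous (fun t => B t w)}},
      (forall s t, 0 <= s -> s < t -> indep_sigma_rv (F s) (B t \- B s)) &
      (forall s t, 0 <= s -> s < t -> forall A : set R, measurable A ->
         P ((B t \- B s) @^-1` A) = normal_prob 0 (Num.sqrt (t - s)) A)].
End defs.

Definition resolvent {R : realType} (a : R) (k r : R -> R) : Prop :=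
  [/\ r 0 = 1,
      {within `[0, +oo[%classic, continuous r},
      (forall t : R, 0 < t -> is_derive t (1 : R) r
         (a * r t + \int[lebesgue_measure]_(s in `[0, t]) (k (t - s) * r s))) &
      (fun h : R => h^-1 * (r h - r 0)) @ (0 : R)^'+ -->
         (a * r 0 + \int[lebesgue_measure]_(s in `[0, 0]) (k (0 - s) * r s))].

(* Main.v *)
Require Import Defs.
From HB Require Import structures.
From mathcomp Require Import all_boot all_order all_algebra.
From mathcomp Require Import all_classical all_reals all_analysis.
From mathcomp Require Import ring lra unstable measurable_realfun.
Import Order.TTheory GRing.Theory Num.Theory.
Import numFieldNormedType.Exports.
Local Open Scope classical_set_scope.
Local Open Scope ring_scope.
Set Implicit Arguments. Unset Strict Implicit. Unset Printing Implicit Defensive.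

(** Write rho = a r + k * r = r' (with * the convolution on [0, t]).  Pathwise, integrating
    r (t - s) Z (s) by parts, with Z = X - sig B of class C^1, and using the associativity
    r * (k * X) = (k * r) * X, gives the variation of constants formula
      X t = r t X0 + sig J t,   J t = B t + int_0^t rho (t - u) B u du,
    so that no stochastic integral is needed.  J t is the almost sure limit of Riemann sums,
    which are finite linear combinations of values of B.  Since E[B u B v] = min (u, v) is the
    L^2 inner product of the indicators of [0, u[ and [0, v[, the second moments of these sums
    are inner products of step functions, and the step functions converge to
    x |-> r (t - x) 1_{x < t}.  Fatou's lemma turns the almost sure limit into an L^2 limit, and
      Cov (X s, X (s + t)) = r s r (s + t) Var X0 + sig^2 int_0^s r u r (u + t) du.
    Finally r is bounded: |r'| <= K max |r|, so near a point where |r| reaches its maximum M on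
    [0, t] it stays above M / 2 on an interval of length 1 / (2 K), and r is in L^2.  Hence r is
    Lipschitz and square integrable, so it tends to 0. *)

(** * Convolution of continuous functions *)

(** The hypotheses control [k], [r] and the paths only on the half-line, [r] is known to be
    differentiable only at positive times, and the path properties hold only almost everywhere.
    Three choices absorb this. Functions of time are replaced by their even extensions, composed
    with the absolute value, which are continuous on the whole line and unchanged at nonnegative
    times. The process [J] is defined in the final proof as [sig^-1 * (X s w - rr s * X0 w)]: it is
    measurable because [X] is adapted, and the variation of constants formula serves only, almost
    everywhere, to identify [J] with the limit of the Riemann sums. Square integrability of [X] is
    not assumed; it is an output of the Fatou argument. The bridge from probability to step
    functions is that one and the same linear functional [wiener_sum], with fixed nodes and weights,
    is applied to a Brownian path and to [below x]; the isometry is then a comparison of two finite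
    double sums, and Cauchy-Schwarz carries it to the limit. *)

Section continuous_integrals.
Context {R : realType}.
Notation mu := (@lebesgue_measure R).
Implicit Types f g h : R -> R.

Lemma continuous_compR f g : continuous f -> continuous g ->
  continuous (fun x => f (g x)).
Proof. by move=> cf cg x; apply: (@continuous_comp _ _ _ g f); [exact: cg|exact: cf]. Qed.

Lemma continuous_mulR f g : continuous f -> continuous g ->
  continuous (fun x => f x * g x).
Proof. by move=> cf cg x; apply: cvgM; [exact: cf|exact: cg]. Qed.

Lemma continuous_addR f g : continuous f -> continuous g ->
  continuous (fun x => f x + g x).
Proof. by move=> cf cg x; apply: cvgD; [exact: cf|exact: cg]. Qed.

Lemma continuous_subl (a : R) : continuous (fun x : R => a - x).
Proof. by move=> x; apply: cvgB; [exact: cvg_cst|exact: cvg_id]. Qed.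

Lemma continuous_integrable f a b : continuous f ->
  mu.-integrable `[a, b] (EFin \o f).
Proof.
move=> cf; apply: continuous_compact_integrable; first exact: segment_compact.
exact: continuous_subspaceT.
Qed.

(** Substitution [u = t * x]. It moves the parameter from the domain into the integrand, so that
    [convol] can be studied over the fixed segment [0, 1]. At [t = 0] the substitution is not
    increasing, hence the separate case. *)
Lemma Rintegral_scale f t : 0 <= t -> continuous f ->
  \int[mu]_(x in `[0, t]) f x = t * \int[mu]_(x in `[0, 1]) f (t * x).
Proof.
rewrite le_eqVlt => /predU1P[<- _|t0 cf].
  by rewrite set_itv1 Rintegral_set1 mul0r.
have cft : continuous (fun x => f (t * x)).
  by apply: continuous_compR => //; exact: mulrl_continuous.
have dE x : is_derive x (1:R) (fun x : R => t * x) t.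
  by apply: is_derive_eq; rewrite /= scaler1.
have dE1 : ((fun x : R => t * x)^`() = cst t)%classic.
  by apply/funext => x; rewrite derive1E; apply: derive_val.
have := @integration_by_substitution_increasing R (fun x => t * x) f 0 1 ler01.
rewrite mulr0 mulr1 /Rintegral => -> //.
- rewrite -[RHS]RintegralZl//; last exact: continuous_integrable.
  by congr fine; apply: eq_integral => x _; rewrite dE1 /= mulrC.
- by move=> x y _ _ xy; rewrite ltr_pM2l.
- by rewrite dE1 => x _; exact: cst_continuous.
- by rewrite dE1; exact: is_cvg_cst.
- by rewrite dE1; exact: is_cvg_cst.
- split.
  + by move=> x _; apply: ex_derive.
  + by apply: cvg_at_right_filter; exact: mulrl_continuous.
  + by apply: cvg_at_left_filter; exact: mulrl_continuous.
- exact: continuous_subspaceT.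
Qed.

Lemma Rintegral_reflect f t : 0 <= t -> continuous f ->
  \int[mu]_(x in `[0, t]) f (t - x) = \int[mu]_(x in `[0, t]) f x.
Proof.
move=> t0 cf.
have cfB : continuous (fun x : R => f (t - x)).
  by apply: continuous_compR => //; exact: continuous_subl.
rewrite Rintegral_scale// [RHS]Rintegral_scale//; congr (_ * _).
rewrite (@Rintegration_by_substitution_onem R (fun x => f (t * x)) 1)//.
- rewrite /onem subrr; apply: eq_Rintegral => x _; congr (f _).
  by rewrite mulrBr mulr1.
- by rewrite ler01 lexx.
- apply: continuous_subspaceT; apply: continuous_compR => //.
  exact: mulrl_continuous.
Qed.

(* The scaled form of [\int_0^t f (t - s) * g s ds]: defined and continuous on the whole line. *)
Definition convol f g t :=
  t * \int[mu]_(x in `[0, 1]) (f (t * (1 - x)) * g (t * x)).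

Lemma convolE f g t : 0 <= t -> continuous f -> continuous g ->
  convol f g t = \int[mu]_(s in `[0, t]) (f (t - s) * g s).
Proof.
move=> t0 cf cg; rewrite Rintegral_scale//; last first.
  apply: continuous_mulR => //; apply: continuous_compR => //.
  exact: continuous_subl.
by congr (_ * _); apply: eq_Rintegral => x _; rewrite mulrBr mulr1.
Qed.

(** The reflection [x -> 1 - x] acts on the unit segment, whence no sign condition on [t]. *)
Lemma convolC f g t : continuous f -> continuous g ->
  convol f g t = convol g f t.
Proof.
move=> cf cg; congr (_ * _).
have c1 : continuous (fun x : R => f (t * x)).
  by apply: continuous_compR => //; exact: mulrl_continuous.
have c2 : continuous (fun x : R => g (t * (1 - x))).
  apply: continuous_compR => //; apply: continuous_compR; last exact: continuous_subl.
  exact: mulrl_continuous.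
rewrite -[RHS](@Rintegral_reflect (fun x => g (t * (1 - x)) * f (t * x)) 1)//.
- by apply: eq_Rintegral => x _; rewrite mulrC opprB addrCA subrr addr0.
- exact: continuous_mulR.
Qed.

Lemma bounded_on_segment f a b : continuous f ->
  exists2 M : R, 0 < M & forall x, x \in `[a, b] -> `|f x| <= M.
Proof.
move=> cf; have [ab|ba] := leP a b; last first.
  exists 1 => // x; rewrite in_itv/= => /andP[ax xb].
  by have := le_lt_trans (le_trans ax xb) ba; rewrite ltxx.
have cnf : {within `[a, b], continuous (fun x => `|f x|)}.
  by apply: continuous_subspaceT => x; apply: cvg_norm; exact: cf.
have [c _ cM] := EVT_max ab cnf.
exists (`|f c| + 1); first by rewrite ltr_wpDl.
by move=> x xab; rewrite (le_trans (cM x xab))// lerDl.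
Qed.

Lemma convol_continuous f g : continuous f -> continuous g ->
  continuous (convol f g).
Proof.
move=> cf cg t; apply: cvgM; first exact: cvg_id.
pose F (l x : R) := f (l * (1 - x)) * g (l * x).
have cFl x : continuous (F ^~ x).
  by apply: continuous_mulR; apply: continuous_compR => //; exact: mulrr_continuous.
have cFx l : continuous (F l).
  apply: continuous_mulR; apply: continuous_compR => //; last exact: mulrl_continuous.
  by apply: continuous_compR; [exact: mulrl_continuous|exact: continuous_subl].
(* Any bound exceeding [|t|] would do: for [|l| < A] and [x] in [0, 1] both [l * (1 - x)] and
   [l * x] stay in [-A, A], so the constant [M * N] dominates the integrands uniformly near [t]. *)
pose A := `|t| + 1.
have A0 : 0 <= A by rewrite addr_ge0.
have [M M0 HM] := bounded_on_segment (- A) A cf.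
have [N N0 HN] := bounded_on_segment (- A) A cg.
have tA : t \in `]- A, A[%classic.
  rewrite inE/= in_itv/=; apply/andP; split.
    by rewrite /A ltrNl -normrN (le_lt_trans (ler_norm _))// ltrDl.
  by rewrite /A (le_lt_trans (ler_norm _))// ltrDl.
apply: (@continuity_under_integral R _ _ mu F `[0, 1]%classic _ (- A) A _ _ (cst (M * N)) _ _ t tA) => //.
- by move=> x _; apply: continuous_integrable; exact: cFx.
- by apply: aeW => x _ l _; exact: cFl.
- by apply: continuous_integrable => x; exact: cvg_cst.
- move=> l; rewrite /= in_itv/= => /andP[lA1 lA2]; apply: aeW => x /=.
  rewrite in_itv/= => /andP[x0 x1].
  have key y : 0 <= y <= 1 -> l * y \in `[- A, A].
    move=> /andP[y0 y1]; rewrite in_itv/= -ler_norml normrM (ger0_norm y0).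
    by rewrite (@le_trans _ _ (`|l|))// ?ler_piMr// ler_norml !ltW.
  rewrite normrM ler_pM// ?HM ?HN// key//; last by rewrite x0.
  by rewrite subr_ge0 x1/= gerBl.
Qed.

End continuous_integrals.

(** * Associativity of the convolution, by Fubini on a triangle *)

Section convolution_associativity.
Context {R : realType}.
Notation mu := (@lebesgue_measure R).

Lemma indic_itvE (i : interval R) (x : R) :
  \1_[set` i] x = (x \in i)%:R :> R.
Proof. by rewrite indicE mem_setE. Qed.

Lemma square_indicator_integrable (t C : R) :
  (mu \x mu)%E.-integrable setT
    (fun z : measurableTypeR R * measurableTypeR R =>
      (C * \1_(`[0, t]%classic `*` `[0, t]%classic) z)%:E).
Proof.
under eq_fun do rewrite EFinM.
apply: integrableZl => //; apply/integrableP; split.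
  by apply/measurable_EFinP; apply: measurable_indic; exact: measurableX.
under eq_integral do rewrite gee0_abs ?lee_fin//.
rewrite integral_indic ?setIT//; last exact: measurableX.
rewrite -[X in (X < _)%E]/((mu \x mu)%E (`[0%R, t]%classic `*` `[0%R, t]%classic)).
rewrite (@product_measure1E _ _ _ _ R mu mu)//=.
have H : (mu `[0%R, t]%classic < +oo)%E.
  by rewrite lebesgue_measure_itv/=; case: ifP => _; rewrite ?ltry// -EFinD ltry.
by rewrite lte_mul_pinfty// ge0_fin_numE.
Qed.

(** Associativity and commutativity in one symmetric identity: both sides are the double integral of
    [k (t - x - y) * f * g] over the triangle [x, y >= 0], [x + y <= t], with the roles of the two
    variables exchanged. *)
Lemma convol_swap (k f g : R -> R) (t : R) : 0 <= t ->
  continuous k -> continuous f -> continuous g ->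
  \int[mu]_(s in `[0, t]) (convol k f (t - s) * g s) =
  \int[mu]_(s in `[0, t]) (convol k g (t - s) * f s).
Proof.
move=> t0 ck cf cg.
(* The triangle is cut out by a product of three one-dimensional indicators, so that [F] is
   measurable factor by factor; [FE0] merges them into one condition. On the triangle all arguments
   lie in [0, t], which makes [F] bounded by a constant on the square, hence integrable. *)
pose F (a b : R -> R) (z : measurableTypeR R * measurableTypeR R) : R :=
  k (t - z.1 - z.2) * b z.2 * a z.1 *
  (\1_(`[0, +oo[%classic) z.1 * \1_(`[0, +oo[%classic) z.2 *
   \1_(`]-oo, t]%classic) (z.1 + z.2)).
have FE0 a b x y : F a b (x, y) = k (t - x - y) * b y * a x *
    [&& 0 <= x, 0 <= y & x + y <= t]%:R.
  rewrite /F/= !indic_itvE !in_itv/= !andbT -!natrM !mulnb.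
  by rewrite andbA.
have m1 : measurable_fun setT (@fst (measurableTypeR R) (measurableTypeR R)) by [].
have m2 : measurable_fun setT (@snd (measurableTypeR R) (measurableTypeR R)) by [].
have mc (h : R -> R) : continuous h -> measurable_fun setT h
  by exact: continuous_measurable_fun.
have mF a b : continuous a -> continuous b -> measurable_fun setT (F a b).
  move=> ca cb; repeat apply: measurable_funM.
  - apply: (measurableT_comp (mc _ ck)).
    by apply: measurable_funB => //; apply: measurable_funB.
  - exact: (measurableT_comp (mc _ cb) m2).
  - exact: (measurableT_comp (mc _ ca) m1).
  - by apply: (measurableT_comp _ m1) => //; exact: measurable_indic.
  - by apply: (measurableT_comp _ m2) => //; exact: measurable_indic.
  - by apply: measurableT_comp; [exact: measurable_indic|exact: measurable_funD].
have iF a b : continuous a -> continuous b ->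
    (mu \x mu)%E.-integrable setT (EFin \o F a b).
  move=> ca cb.
  have [M1 M10 HM1] := bounded_on_segment 0 t ck.
  have [M2 M20 HM2] := bounded_on_segment 0 t cb.
  have [M3 M30 HM3] := bounded_on_segment 0 t ca.
  apply: (le_integrable _ _ _ (square_indicator_integrable t (M1 * M2 * M3))) => //.
    by apply/measurable_EFinP; exact: mF.
  move=> [x y] _ /=; rewrite lee_fin FE0 indicE.
  rewrite [X in _ <= X]ger0_norm; last by rewrite !mulr_ge0// ltW.
  have [/and3P[x0 y0 xyt]|_] := boolP [&& 0 <= x, 0 <= y & x + y <= t]; last first.
    by rewrite mulr0 normr0 !mulr_ge0// ltW.
  rewrite normrM !normrM ler_pM ?mulr_ge0//.
    rewrite !ler_pM ?mulr_ge0// ?HM1 ?HM2 ?HM3// in_itv/=; lra.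
  rewrite ger0_norm//.
  suff : (x, y) \in (`[0, t]%classic `*` `[0, t]%classic : set (R * R)) by move=> ->.
  by apply/mem_set; split => /=; rewrite in_itv/=; lra.
(* The section of the triangle at [x] in [0, t] is the segment [0, t - x], whose integral is the
   inner convolution. *)
have FE a b : continuous a -> continuous b -> forall x : R,
    (\int[mu]_y (F a b (x, y))%:E)%E =
    (((fun x => convol k b (t - x) * a x) \_ `[0, t]) x)%:E.
  move=> ca cb x; rewrite patchE mem_setE in_itv/=.
  have [/andP[x0 xt]|xt] := boolP (0 <= x <= t); last first.
    rewrite integral0_eq// => y _; congr EFin.
    rewrite FE0; suff -> : [&& 0 <= x, 0 <= y & x + y <= t] = false by rewrite mulr0.
    by apply: contraNF xt => /and3P[? ? ?]; lra.
  rewrite convolE ?subr_ge0// -RintegralZr//; last first.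
    apply: continuous_integrable; apply: continuous_mulR => //.
    by apply: continuous_compR => //; exact: continuous_subl.
  rewrite /Rintegral fineK; last first.
    apply: integrable_fin_num => //; apply: continuous_integrable.
    apply: continuous_mulR; last by move=> ?; exact: cvg_cst.
    apply: continuous_mulR => //.
    by apply: continuous_compR => //; exact: continuous_subl.
  rewrite [RHS]integral_mkcond; apply: eq_integral => y _.
  rewrite patchE mem_setE in_itv/= FE0 x0 /= lerBrDl.
  by case: (_ && _); rewrite ?mulr1 ?mulr0.
have key a b : continuous a -> continuous b ->
    \int[mu]_(s in `[0, t]) (convol k b (t - s) * a s) =
    fine (\int[mu]_x \int[mu]_y (F a b (x, y))%:E)%E.
  move=> ca cb; rewrite Rintegral_mkcond /Rintegral; congr fine.
  by apply: eq_integral => x _; rewrite FE.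
rewrite (key g f)// (key f g)//; congr fine.
rewrite (Fubini (iF g f cg cf)).
apply: eq_integral => y _; apply: eq_integral => x _; congr EFin.
rewrite !FE0 (addrC y) andbCA (addrAC t) -!mulrA; congr (_ * _).
by rewrite mulrCA.
Qed.

End convolution_associativity.

(** * Variation of constants *)

Section volterra_representation.
Context {R : realType}.
Notation mu := (@lebesgue_measure R).
Variables (a : R) (k r : R -> R).
Hypotheses (ck : continuous k) (cr : continuous r).

Let rho t := a * r t + convol k r t.

Lemma resolvent_slope_continuous : continuous (fun t => a * r t + convol k r t).
Proof.
apply: continuous_addR; last exact: convol_continuous.
by apply: continuous_mulR => // x; exact: cvg_cst.
Qed.

Let crho : continuous rho := resolvent_slope_continuous.

Hypothesis r0 : r 0 = 1.
Hypothesis dr : forall t : R, 0 < t -> is_derive t (1 : R) r (rho t).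

(** In convolution notation, [r * (a x + k * x) = (a r + k * r) * x]: the kernel is moved from [x]
    to [r] by [convol_swap], and the resolvent equation names the result [rho]. *)
Lemma convol_resolvent_drift (x : R -> R) (t : R) : 0 <= t -> continuous x ->
  \int[mu]_(s in `[0, t]) (r (t - s) * (a * x s + convol k x s)) =
  \int[mu]_(s in `[0, t]) (rho (t - s) * x s).
Proof.
move=> t0 cx.
have ckx := convol_continuous ck cx.
have ckr := convol_continuous ck cr.
have cs := @continuous_subl R t.
have cax : continuous (fun s => a * x s).
  by apply: continuous_mulR => // y; exact: cvg_cst.
rewrite -(@convolE R r (fun s => a * x s + convol k x s))//; last exact: continuous_addR.
rewrite convolC//; last exact: continuous_addR.
rewrite convolE//; last exact: continuous_addR.
under eq_Rintegral do rewrite mulrDl -mulrA.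
have ci (u v : R -> R) : continuous u -> continuous v ->
    mu.-integrable `[0, t] (EFin \o (fun s => u (t - s) * v s)).
  move=> cu cv; apply: continuous_integrable; apply: continuous_mulR => //.
  exact: continuous_compR.
have cai (u v : R -> R) : continuous u -> continuous v ->
    mu.-integrable `[0, t] (EFin \o (fun s => a * (u (t - s) * v s))).
  move=> cu cv; apply: continuous_integrable; apply: continuous_mulR => //.
    by move=> y; exact: cvg_cst.
  by apply: continuous_mulR => //; exact: continuous_compR.
rewrite RintegralD//; [|exact: cai|exact: ci].
rewrite RintegralZl//; last exact: ci.
rewrite convol_swap// -(@convolE R x r)// convolC// convolE//.
rewrite -RintegralZl//; last exact: ci.
rewrite -RintegralD//; [|exact: cai|exact: ci].
by apply: eq_Rintegral => s _; rewrite /rho mulrDl mulrA.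
Qed.

(** Integration by parts of [r (t - s)] against the derivative of [x - sig * b] leaves the boundary
    terms [x t - sig * b t] and [r t * x0]. The integral of [rho (t - s) * x s] occurs on both
    sides, once by parts and once through [convol_resolvent_drift]; it cancels and only [b] remains
    under the integral. *)
Lemma volterra_representation (x b : R -> R) (x0 sig : R) :
  continuous x -> continuous b ->
  (forall t, 0 <= t -> x t = x0 +
    \int[mu]_(u in `[0, t]) (a * x u + convol k x u) + sig * b t) ->
  forall t, 0 <= t ->
    x t = r t * x0 + sig * (b t + \int[mu]_(u in `[0, t]) (rho (t - u) * b u)).
Proof.
move=> cx cb xE t; rewrite le_eqVlt => /predU1P[<-|t0].
  by rewrite xE// set_itv1 !Rintegral_set1 !addr0 r0 mul1r.
pose D u := a * x u + convol k x u.
have cD : continuous D.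
  apply: continuous_addR; last exact: convol_continuous.
  by apply: continuous_mulR => // y; exact: cvg_cst.
pose I u := \int[mu]_(v in `[0, u]) D v.
have iD u : mu.-integrable `[0, u] (EFin \o D) by exact: continuous_integrable.
have cs := @continuous_subl R t.
have dG (s : R) : 0 < s -> is_derive s (1 : R) I (D s).
  move=> s0; have ss1 : s < s + 1 by rewrite ltrDl.
  have [d1 d2] := @continuous_FTC1_closed R D 0 s (s + 1) ss1 (iD _) s0 (cD s).
  by apply: DeriveDef; [exact: d1|rewrite -derive1E].
have cIw : {within `[0, t], continuous I}.
  exact: (parameterized_integral_continuous (ltW t0) (iD t)).
(* Differentiability is available only inside the interval: [dG] needs [0 < s], and [dF] below needs
   [s < t] because [r] is differentiable at positive times. The end points are covered by one-sided
   limits. *)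
have G_LR : derivable_oo_LRcontinuous (fun s => x0 + I s) 0 t.
  have [_ Il Ir] := (continuous_within_itvP I t0).1 cIw.
  split.
  - move=> s; rewrite in_itv/= => /andP[s0 _].
    have := dG _ s0 => ?; apply: derivableD; [exact: derivable_cst|exact: ex_derive].
  - by apply: cvgD; [exact: cvg_cst|exact: Il].
  - by apply: cvgD; [exact: cvg_cst|exact: Ir].
have dF (s : R) : s < t -> is_derive s (1 : R) (fun s => r (t - s)) (- rho (t - s)).
  move=> st; have d1 : is_derive (t - s) (1 : R) r (rho (t - s)).
    by apply: dr; rewrite subr_gt0.
  have d2 : is_derive s (1 : R) (fun s => t - s) (- 1).
    by apply: is_derive_eq; rewrite add0r mul1r.
  have := @is_derive1_comp R r (fun s => t - s) s _ _ d1 d2.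
  by rewrite mulrN1.
have F_LR : derivable_oo_LRcontinuous (fun s => r (t - s)) 0 t.
  have c : continuous (fun s => r (t - s)) by exact: continuous_compR.
  split.
  - move=> s; rewrite in_itv/= => /andP[_ st].
    by have := dF _ st => ?; exact: ex_derive.
  - by apply: cvg_at_right_filter; exact: c.
  - by apply: cvg_at_left_filter; exact: c.
have cf : continuous (fun s => - rho (t - s)).
  by move=> y; apply: cvgN; exact: (continuous_compR crho cs).
have ZE s : 0 <= s -> x0 + I s = x s - sig * b s.
  by move=> s0; rewrite xE//; rewrite addrK.
have F' : {in `]0, t[, ((fun s => r (t - s))^`())%classic =1 (fun s => - rho (t - s))}.
  move=> s; rewrite in_itv/= => /andP[_ st]; rewrite derive1E.
  by have := dF _ st => ?; apply: derive_val.
have G' : {in `]0, t[, ((fun s => x0 + I s)^`())%classic =1 D}.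
  move=> s; rewrite in_itv/= => /andP[s0 _]; rewrite derive1E.
  have := dG _ s0 => ?; rewrite deriveD//.
  by rewrite derive_cst add0r; exact: derive_val.
have := @Rintegration_by_parts R _ _ _ _ 0 t t0 (continuous_subspaceT cf) F_LR F'
   (continuous_subspaceT cD) G_LR G'.
have I0 : I 0 = 0 by rewrite /I set_itv1 Rintegral_set1.
rewrite subrr subr0 r0 mul1r I0 addr0.
have ci (u v : R -> R) : continuous u -> continuous v ->
    mu.-integrable `[0, t] (EFin \o (fun s => u (t - s) * v s)).
  move=> cu cv; apply: continuous_integrable; apply: continuous_mulR => //.
  exact: continuous_compR.
have E1 : \int[mu]_(s in `[0, t]) (- rho (t - s) * (x0 + I s)) =
    sig * \int[mu]_(s in `[0, t]) (rho (t - s) * b s) -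
    \int[mu]_(s in `[0, t]) (rho (t - s) * x s).
  rewrite -RintegralZl//; last exact: ci.
  rewrite -RintegralB//; [|apply: continuous_integrable|exact: ci].
    apply: eq_Rintegral => s; rewrite inE/= in_itv/= => /andP[s0 _].
    by rewrite ZE//; ring.
  apply: continuous_mulR; first by move=> y; exact: cvg_cst.
  by apply: continuous_mulR => //; exact: continuous_compR.
rewrite E1 (convol_resolvent_drift (ltW t0) cx) ZE ?(ltW t0)//.
set A := \int[mu]_(_ in _) _; set B := \int[mu]_(_ in _) _ => ibp; lra.
Qed.

End volterra_representation.

(** * Decay of the resolvent *)

Section decay.
Context {R : realType}.
Notation mu := (@lebesgue_measure R).

(** The limit is tested along sequences tending to infinity; there the truncations of [f] converge
    pointwise and are dominated by [|f|]. *)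
Lemma cvg_Rintegral_0y (f : R -> R) :
  mu.-integrable `[0, +oo[ (EFin \o f) ->
  \int[mu]_(x in `[0, s]) f x @[s --> +oo] -->
  \int[mu]_(x in `[0, +oo[) f x.
Proof.
move=> fi; apply/cvg_pinftyP => u uoo.
have mf := measurable_int mu fi.
pose g n := (EFin \o f) \_ `[0, u n].
have E n : \int[mu]_(x in `[0, u n]) f x = fine (\int[mu]_(x in `[0%R, +oo[) g n x)%E.
  rewrite /Rintegral; congr fine.
  rewrite -integral_mkcondr; congr (integral _ _ _); apply/esym/setIidPr => x /=.
  by rewrite !in_itv/= andbT => /andP[].
under eq_fun do rewrite E.
apply: fine_cvg; rewrite fineK; last exact: integrable_fin_num.
have := @dominated_convergence _ _ R mu `[0, +oo[%classic (measurable_itv _) g (EFin \o f)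
  (abse \o (EFin \o f)).
case => //.
- move=> n; rewrite /g; apply/(measurable_restrict _ _ _) => //.
  by apply: measurable_funS mf => // x [].
- apply: aeW => x x0; apply: cvg_near_cst; near=> n.
  rewrite /g patchE mem_setE in_itv/=; move: x0; rewrite /= in_itv/= andbT => ->/=.
  rewrite ifT//; near: n; exact: (cvgryPge u).1.
- exact: integrable_abse.
- apply: aeW => x n x0; rewrite /g patchE; case: ifP => // _.
  by rewrite (_ : point = 0%E)// abse0 abse_ge0.
Unshelve. all: by end_near. Qed.

Variables (a : R) (k r : R -> R).
Hypotheses (ck : continuous k) (cr : continuous r).
Variable Kk : R.
Hypothesis kK : forall t, 0 <= t -> \int[mu]_(x in `[0, t]) `|k x| <= Kk.
Hypothesis dr : forall t : R, 0 < t ->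
  is_derive t (1 : R) r (a * r t + convol k r t).
Hypothesis r2i : mu.-integrable `[0, +oo[ (fun s => (r s ^+ 2)%:E).

Let energy t := \int[mu]_(x in `[0, t]) (r x ^+ 2).
Let Q := \int[mu]_(x in `[0, +oo[) (r x ^+ 2).
(** [|a| + Kk] already bounds the operator sending [r] to its slope; the added 1 makes [K] positive,
    so that it can be inverted. *)
Let K := `|a| + Kk + 1.

Let Kk0 : 0 <= Kk.
Proof. by rewrite (le_trans _ (kK (lexx 0)))// set_itv1 Rintegral_set1. Qed.

Let K0 : 0 < K.
Proof. by rewrite /K ltr_wpDl// addr_ge0. Qed.

Let cr2 : continuous (fun x => r x ^+ 2).
Proof. by move=> x; under eq_fun do rewrite expr2; exact: continuous_mulR. Qed.

Let slope_le u M : 0 <= u -> (forall v, v \in `[0, u] -> `|r v| <= M) ->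
  `|a * r u + convol k r u| <= K * M.
Proof.
move=> u0 rM.
have uu : u \in `[0, u] by rewrite in_itv/= u0 lexx.
have M0 : 0 <= M by rewrite (le_trans _ (rM _ uu)).
rewrite (le_trans (ler_normD _ _))// normrM !mulrDl.
rewrite -[leLHS]addr0 lerD//; last by rewrite mul1r.
rewrite lerD//; first by rewrite ler_wpM2l// rM.
have cs := @continuous_subl R u.
have ci : continuous (fun s => k (u - s) * r s).
  by apply: continuous_mulR => //; exact: continuous_compR.
have cn : continuous (fun s => `|k s|) by move=> x; apply: cvg_norm; exact: ck.
rewrite convolE// (le_trans (le_normr_Rintegral _ _))//; first exact: continuous_integrable.
have cn' : continuous (fun s => `|k (u - s)|) by exact: (continuous_compR cn cs).
apply: (@le_trans _ _ (\int[mu]_(s in `[0, u]) (`|k (u - s)| * M))).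
  apply: le_Rintegral => //.
  - by apply: continuous_integrable => x; apply: cvg_norm; exact: ci.
  - by apply: continuous_integrable; apply: continuous_mulR => // x; exact: cvg_cst.
  - by move=> x ?; rewrite normrM ler_wpM2l// rM.
rewrite RintegralZr//; last exact: continuous_integrable.
by rewrite (Rintegral_reflect u0 cn) ler_wpM2r// kK.
Qed.

(** Turns pointwise size into energy. It is applied with [m = |r c| / 2] for the bound and with
    [m = e / 2] for the decay. *)
Let energy_split s t m : 0 <= s -> s <= t -> 0 <= m ->
  (forall u, u \in `[s, t] -> m <= `|r u|) ->
  (t - s) * m ^+ 2 <= energy t - energy s.
Proof.
move=> s0 st m0 mr; rewrite /energy Rintegral_itvB ?bnd_simp//; last exact: continuous_integrable.
have -> : (t - s) * m ^+ 2 = \int[mu]_(x in `]s, t]) (m ^+ 2).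
  rewrite Rintegral_cst//= lebesgue_measure_itv/= lte_fin.
  case: ltgtP st => //= [st _|-> _]; first by rewrite mulrC.
  by rewrite subrr mul0r mulr0.
have sub : `]s, t]%classic `<=` `[s, t]%classic by exact: subset_itv_oc_cc.
have ioc (f : R -> R) : continuous f -> mu.-integrable `]s, t] (EFin \o f).
  by move=> cf; apply: (@integrableS _ _ _ mu `[s, t]%classic `]s, t]%classic) => //; exact: continuous_integrable.
apply: le_Rintegral => //.
- by apply: ioc => x; exact: cvg_cst.
- exact: ioc.
- move=> x xst; rewrite -(real_normK (num_real (r x))) lerXn2r ?nnegrE//.
  apply: mr; move: xst; rewrite /= !in_itv/= => /andP[/ltW -> ->//].
Qed.

Let energy_le t : 0 <= t -> energy t <= Q.
Proof.
move=> t0; rewrite /energy /Q /Rintegral fine_le//.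
- by apply: integrable_fin_num => //; exact: continuous_integrable.
- exact: integrable_fin_num.
- apply: ge0_subset_integral => //.
  + by case/integrableP: r2i.
  + by move=> x _; rewrite lee_fin sqr_ge0.
  + by move=> x /=; rewrite !in_itv/= => /andP[->].
Qed.

Let energy_ge0 t : 0 <= energy t.
Proof. by apply: Rintegral_ge0 => x _; exact: sqr_ge0. Qed.

Let Q0 : 0 <= Q. Proof. exact: le_trans (energy_ge0 0) (energy_le _). Qed.

Let lipschitz s t L : 0 <= s -> s <= t ->
  (forall u, u \in `[s, t] -> `|a * r u + convol k r u| <= L) ->
  `|r t - r s| <= L * (t - s).
Proof.
move=> s0 st HL.
have [||c cst ->] := @MVT_segment R r (fun u => a * r u + convol k r u) s t st.
- move=> x; rewrite in_itv/= => /andP[sx _]; exact: dr (le_lt_trans s0 sx).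
- exact: continuous_subspaceT.
- by rewrite normrM (ger0_norm (_ : 0 <= t - s)) ?subr_ge0// ler_wpM2r ?subr_ge0 ?HL.
Qed.

Lemma resolvent_bounded : exists2 M, 0 < M & forall t, 0 <= t -> `|r t| <= M.
Proof.
pose h := (2 * K)^-1.
have h0 : 0 < h by rewrite invr_gt0 mulr_gt0.
have hK : K * h = 2^-1 by rewrite /h invfM mulrCA divff ?mulr1// gt_eqF.
have [M0 M00 HM0] := bounded_on_segment 0 h cr.
have y0 : 0 <= 4 * Q / h by apply: divr_ge0; [apply: mulr_ge0; [by []|exact: Q0]|exact: ltW].
(* If the maximum is attained at [c <= h], then [M0] bounds it, as [c - h, c] may leave the
   half-line. Otherwise the energy on [c - h, c] gives [h * (|r c| / 2) ^ 2 <= Q], so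
   [|r c| ^ 2 <= 4 * Q / h <= M <= M ^ 2], the last inequality because [M >= 1]. *)
pose M := M0 + 4 * Q / h + 1.
have MM0 : 0 < M by rewrite /M; lra.
exists M => // t t0.
have cn : {within `[0, t], continuous (fun x => `|r x|)}.
  by apply: continuous_subspaceT => x; apply: cvg_norm; exact: cr.
have [c] := EVT_max t0 cn; rewrite in_itv/= => /andP[c0 ct] cmax.
apply: (@le_trans _ _ `|r c|); first by apply: cmax; rewrite in_itv/= t0 lexx.
have [ch|hc] := leP c h.
  by rewrite (le_trans (HM0 _ _)) ?in_itv/= ?c0// /M; lra.
have ch0 : 0 <= c - h by rewrite subr_ge0 ltW.
have chc : c - h <= c by rewrite gerBl ltW.
have low u : u \in `[c - h, c] -> `|r c| / 2 <= `|r u|.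
  rewrite in_itv/= => /andP[u1 u2].
  have u0 : 0 <= u by exact: le_trans u1.
  have H : `|r c - r u| <= K * `|r c| * (c - u).
    apply: lipschitz => // v; rewrite in_itv/= => /andP[v1 v2].
    apply: slope_le; first exact: le_trans v1.
    move=> w; rewrite in_itv/= => /andP[w1 w2]; apply: cmax; rewrite in_itv/= w1/=.
    by rewrite (le_trans w2)// (le_trans v2).
  have : K * `|r c| * (c - u) <= `|r c| / 2.
    rewrite -[2^-1]hK mulrCA mulrA ler_wpM2l ?mulr_ge0 ?(ltW K0)//; lra.
  by have := lerB_dist (r c) (r u); lra.
have := energy_split ch0 chc _ low; rewrite divr_ge0// opprB addrCA subrr addr0 => /(_ isT) H.
have {}H : h * (`|r c| / 2) ^+ 2 <= Q.
  by rewrite (le_trans H)// (le_trans _ (energy_le c0))// gerBl.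
rewrite -(@ler_pXn2r _ 2)// ?nnegrE ?(ltW MM0)//.
apply: (@le_trans _ _ (4 * Q / h)).
  by rewrite ler_pdivlMr// (le_trans _ (_ : 4 * (h * (`|r c| / 2) ^+ 2) <= _))//; [rewrite expr_div_n; lra|rewrite ler_wpM2l].
rewrite /M expr2; nra.
Qed.

Lemma resolvent_cvg0 : r t @[t --> +oo] --> (0 : R).
Proof.
have [M M0 HM] := resolvent_bounded.
pose L := K * M.
have L0 : 0 < L by rewrite mulr_gt0.
have slopeL u : 0 <= u -> `|a * r u + convol k r u| <= L.
  by move=> u0; apply: slope_le => // v; rewrite in_itv/= => /andP[v0 _]; exact: HM.
apply/cvgr0Pnorm_lt => e e0.
(* Over a time [h] the function [r] changes by at most [L * h = e / 2]. If [|r t| >= e], then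
   [|r| >= e / 2] on [t - h, t], and this window carries energy at least [h * (e / 2) ^ 2]; the tail
   of the energy is eventually smaller. *)
pose h := e / (2 * L).
have h0 : 0 < h by rewrite divr_gt0// mulr_gt0.
have Lh : L * h = e / 2 by rewrite /h; field; rewrite gt_eqF.
have eta0 : 0 < h * (e / 2) ^+ 2 by rewrite mulr_gt0// exprn_gt0// divr_gt0.
have := cvg_Rintegral_0y r2i => /cvgrPdist_lt /(_ _ eta0) [A [Ar HA]].
(* Beyond this threshold [t - h] is both nonnegative and larger than [A]. *)
exists (`|A| + 1 + h); split; first exact: num_real.
move=> t tA; rewrite ltNge; apply/negP => et.
have Ath : A < t - h by have := ler_norm A; lra.
have th0 : 0 <= t - h by have := normr_ge0 A; lra.
have tht : t - h <= t by lra.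
have low u : u \in `[t - h, t] -> e / 2 <= `|r u|.
  rewrite in_itv/= => /andP[u1 u2].
  have u0 : 0 <= u by exact: le_trans u1.
  have H : `|r t - r u| <= L * (t - u).
    apply: lipschitz => // v; rewrite in_itv/= => /andP[v1 _]; apply: slopeL.
    exact: le_trans v1.
  have : L * (t - u) <= e / 2 by rewrite -Lh ler_wpM2l ?(ltW L0)//; lra.
  by have := lerB_dist (r t) (r u); lra.
have e20 : 0 <= e / 2 by rewrite divr_ge0// ltW.
have := energy_split th0 tht e20 low.
have := HA _ Ath; rewrite -/Q -/(energy (t - h)) => /(le_lt_trans (ler_norm _)).
have := @energy_le t (le_trans th0 tht).
rewrite (_ : t - (t - h) = h); last by lra.
lra.
Qed.

End decay.

(** * Moments of the normal law *)

Section normal_moments.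
Context {R : realType}.
Notation mu := (@lebesgue_measure R).
Variable s : R.
Hypothesis s0 : s != 0.

Let q := normal_pdf 0 s.

Let s2 : 0 < s ^+ 2. Proof. by rewrite exprn_even_gt0. Qed.

Let qE x : q x = normal_peak s * expR (- x ^+ 2 / (s ^+ 2 *+ 2)).
Proof. by rewrite /q normal_pdfE// /normal_fun subr0. Qed.

Let cq : continuous q. Proof. exact: continuous_normal_pdf. Qed.

Let dq (x : R) : is_derive x (1 : R) q (- (x / s ^+ 2) * q x).
Proof.
rewrite (_ : q = fun x => normal_peak s * expR (- x ^+ 2 / (s ^+ 2 *+ 2))); last exact/funext/qE.
have d1 : is_derive x (1 : R) (fun x : R => - x ^+ 2 / (s ^+ 2 *+ 2)) (- (x / s ^+ 2)).
  have -> : (fun x : R => - x ^+ 2 / (s ^+ 2 *+ 2)) = (fun x : R => (- (s ^+ 2 *+ 2)^-1) * x ^+ 2).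
    by apply/funext => y; rewrite mulNr mulNr mulrC.
  apply: is_derive_eq; rewrite -[LHS]/(- (s ^+ 2 *+ 2)^-1 * (x * 1 + x * 1)).
  by rewrite -mulr_natr; field.
have := @is_derive1_comp R expR (fun x : R => - x ^+ 2 / (s ^+ 2 *+ 2)) x _ _ (is_derive_expR _) d1.
move=> d2; apply: is_derive_eq; rewrite /= /GRing.scale/=.
ring.
Qed.

(** The Radon-Nikodym derivative of the normal law agrees almost everywhere with [q], since both
    have the same integral over every measurable subset of [U]. *)
Lemma integral_normal_prob (f : R -> R) U : measurable U -> continuous f ->
  (normal_prob 0 s).-integrable U (EFin \o f) ->
  (\int[normal_prob 0 s]_(x in U) (f x)%:E =
   \int[mu]_(x in U) (f x * q x)%:E)%E.
Proof.
move=> mU cf fi.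
have dom := normal_prob_dominates (0 : R) s.
rewrite -(Radon_Nikodym_change_of_variables dom)//=.
apply: ae_eq_integral => //.
- apply: emeasurable_funM => //; first by case/integrableP: fi.
  apply: (measurable_int mu).
  by apply: (integrableS _ _ (@subsetT _ _)) => //=; exact: Radon_Nikodym_integrable.
- apply/measurable_EFinP/measurable_funTS/measurable_funM.
    exact: continuous_measurable_fun.
  exact: measurable_normal_pdf.
- under [X in ae_eq _ _ _ X]eq_fun do rewrite EFinM.
  apply: ae_eqe_mul2l; apply: integral_ae_eq => //.
  + by apply: (integrableS _ _ (@subsetT _ _)) => //=; exact: Radon_Nikodym_integrable.
  + by apply/measurable_EFinP/measurable_funTS; exact: measurable_normal_pdf.
  + by move=> E EU mE; rewrite -Radon_Nikodym_integral.
Qed.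

Let q_even x : q (- x) = q x. Proof. by rewrite !qE sqrrN. Qed.

Let window n := `[- n.+1%:R, n.+1%:R]%classic : set R.

Let quad (c x : R) := x ^+ 2 + c * x + 1.

Let cquad c : continuous (quad c).
Proof.
apply: continuous_addR; last by move=> x; exact: cvg_cst.
apply: continuous_addR; first exact: sqr_continuous.
exact: mulrl_continuous.
Qed.

(** The right-hand side is free of [c]: since [q] is even and the window symmetric, the
    contributions of [c] to the two boundary terms cancel. *)
Let quad_window c n : \int[mu]_(x in window n) (quad c x * q x) =
  (s ^+ 2 + 1) * \int[mu]_(x in window n) q x - 2 * s ^+ 2 * (n.+1%:R * q n.+1%:R).
Proof.
pose m : R := n.+1%:R; have m0 : 0 < m by rewrite ltr0n.
(* [F' = (x^2 + c x - s^2) q] because [q' = - x / s^2 q]. *)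
pose F x := - s ^+ 2 * ((x + c) * q x).
pose f x := quad c x * q x - (s ^+ 2 + 1) * q x.
have cqq : continuous (fun x => quad c x * q x) by exact: continuous_mulR.
have csq : continuous (fun x => (s ^+ 2 + 1) * q x).
  by apply: continuous_mulR => // x; exact: cvg_cst.
have cf : continuous f by move=> x; apply: cvgB; [exact: cqq|exact: csq].
have dF (x : R) : is_derive x (1 : R) F (f x).
  have := dq x => ?; apply: is_derive_eq.
  rewrite -[LHS]/(- s ^+ 2 * ((x + c) * (- (x / s ^+ 2) * q x) + q x * (1 + 0))).
  by rewrite /f /quad; field.
have cF : continuous F.
  by move=> x; apply: differentiable_continuous; apply/derivable1_diffP; exact: ex_derive.
have mm : - m < m by lra.
have LR : derivable_oo_LRcontinuous F (- m) m.
  split; first by move=> x _; exact: ex_derive.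
  - by apply: cvg_at_right_filter; exact: cF.
  - by apply: cvg_at_left_filter; exact: cF.
have F' : {in `](- m), m[, (F^`())%classic =1 f}.
  by move=> x _; rewrite derive1E; exact: derive_val.
have := @continuous_FTC2 R f F (- m) m mm (continuous_subspaceT cf) LR F'.
rewrite -EFinB => /(congr1 fine) /=.
rewrite -[LHS]/(\int[mu]_(x in `[- m, m]) f x) RintegralB//; last 2 first.
- exact: continuous_integrable.
- exact: continuous_integrable.
rewrite RintegralZl//; last exact: continuous_integrable.
rewrite /F q_even => H.
rewrite -[X in X = _](subrK ((s ^+ 2 + 1) * \int[mu]_(x in window n) q x)) H -/m.
ring.
Qed.

Let window_nd : nondecreasing_seq window.
Proof.
apply/nondecreasing_seqP => n; rewrite subsetEset => x; rewrite /window/= !in_itv/=.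
have : n.+1%:R <= n.+2%:R :> R by rewrite ler_nat.
by move=> H /andP[H1 H2]; apply/andP; split; lra.
Qed.

Let window_T : \bigcup_n window n = setT.
Proof.
rewrite -subTset => x _; exists (Num.truncn `|x|) => //.
by rewrite /window/= in_itv/= -ler_norml ltW// truncnS_gt.
Qed.

Let window_cvg : \int[mu]_(x in window n) q x @[n --> \oo] --> (1 : R).
Proof.
apply: fine_cvg; rewrite -(integral_normal_pdf (0 : R) s) -window_T.
apply: ge0_nondecreasing_set_cvg_integral.
- exact: window_nd.
- by move=> i; exact: measurable_itv.
- by move=> i; apply/measurable_EFinP/measurable_funTS; exact: measurable_normal_pdf.
- by move=> i x _; rewrite lee_fin normal_pdf_ge0.
Qed.

Let tail_cvg : n.+1%:R * q n.+1%:R @[n --> \oo] --> (0 : R).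
Proof.
(* With [y = m ^ 2 / (2 * s ^ 2)], the inequality [expR y >= 1 + y >= y] gives
   [m * q m <= normal_peak s * m / y = C / m]. *)
pose C := normal_peak s * (s ^+ 2 *+ 2).
have CC : (fun n => C * n.+1%:R^-1) @ \oo --> (0 : R).
  by rewrite -[X in _ --> X](mulr0 C); apply: cvgM; [exact: cvg_cst|exact: cvg_harmonic].
apply: (squeeze_cvgr _ (cvg_cst 0) CC); apply: nearW => n.
set m : R := n.+1%:R; have m0 : 0 < m by rewrite ltr0n.
rewrite mulr_ge0 ?normal_pdf_ge0 ?(ltW m0)//= qE /C.
set y := m ^+ 2 / (s ^+ 2 *+ 2).
have y0 : 0 < y by rewrite divr_gt0 ?exprn_gt0 ?mulrn_wgt0.
rewrite mulNr -/y expRN.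
have : (expR y)^-1 <= y^-1.
  by rewrite lef_pV2 ?posrE ?expR_gt0// (le_trans _ (expR_ge1Dx y))// lerDr.
move=> /(ler_wpM2l (normal_peak_ge0 s)) /(ler_wpM2l (ltW m0)) /le_trans; apply.
rewrite /y invf_div le_eqVlt; apply/orP; left; apply/eqP.
by rewrite -mulr_natr; field; rewrite gt_eqF.
Qed.

(* The quadratic is nonnegative for |c| <= 1, so monotone convergence applies; c = 0 and c = 1
   together give both the variance and the mean. *)
Lemma normal_quad_integral c : `|c| <= 1 ->
  (\int[normal_prob 0 s]_x (x ^+ 2 + c * x + 1)%:E = (s ^+ 2 + 1)%:E)%E.
Proof.
move=> c1; rewrite -window_T.
have quad_ge0 x : 0 <= quad c x.
  have : c ^+ 2 <= 1 by rewrite -(real_normK (num_real c)) expr_le1.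
  rewrite /quad; nra.
have mq : measurable_fun setT (quad c) by exact: continuous_measurable_fun.
have H1 : (\int[normal_prob 0 s]_(x in window i) (quad c x)%:E)%E @[i --> \oo] -->
    (\int[normal_prob 0 s]_(x in \bigcup_i window i) (quad c x)%:E)%E.
  apply: ge0_nondecreasing_set_cvg_integral.
  - exact: window_nd.
  - by move=> i; exact: measurable_itv.
  - by move=> i; apply/measurable_EFinP; exact: measurable_funTS.
  - by move=> i x _; rewrite lee_fin.
have E n : (\int[normal_prob 0 s]_(x in window n) (quad c x)%:E)%E =
    ((s ^+ 2 + 1) * \int[mu]_(x in window n) q x - 2 * s ^+ 2 * (n.+1%:R * q n.+1%:R))%:E.
  have iw (f : R -> R) : continuous f -> (normal_prob 0 s).-integrable (window n) (EFin \o f).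
    move=> cf; apply: measurable_bounded_integrable.
    - exact: measurable_itv.
    - apply: le_lt_trans (ltry 1); apply: (@probability_le1 _ _ R (normal_prob 0 s)).
      exact: measurable_itv.
    - by apply: measurable_funTS; exact: continuous_measurable_fun.
    - have [M _ HM] := bounded_on_segment (- n.+1%:R) n.+1%:R cf.
      exists M; split; first exact: num_real.
      by move=> y My x /HM /le_trans; apply; exact: ltW.
  rewrite integral_normal_prob//; [|exact: measurable_itv|exact: iw].
  rewrite -(quad_window c) /Rintegral fineK//.
  apply: integrable_fin_num; first exact: measurable_itv.
  apply: (@continuous_integrable R (fun x => quad c x * q x)).
  exact: continuous_mulR.
rewrite (funext E) in H1; apply: (cvg_unique _ H1) => //.
apply: cvg_EFin; first exact: nearW.
rewrite -[X in _ --> X](_ : (s ^+ 2 + 1) * 1 - 2 * s ^+ 2 * 0 = _); last by rewrite mulr1 mulr0 subr0.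
by apply: cvgB; apply: cvgM => //; exact: cvg_cst.
Qed.

End normal_moments.

(** * Square integrable random variables *)

Section square_integrable.
Context {R : realType} {d : measure_display} {T : measurableType d}.
Variable P : probability T R.
Implicit Types f g h : T -> R.

Definition square_integrable f :=
  measurable_fun setT f /\ P.-integrable setT (EFin \o (fun w => f w ^+ 2)).

(** The L^2 inner product on functions rather than on classes modulo null sets, hence only
    semidefinite. The real-valued integral takes default values when the integral is not finite, so
    the algebraic rules ask for [square_integrable] arguments. *)
Definition inner f g : R := \int[P]_w (f w * g w).

Lemma square_integrable_mul f g : square_integrable f -> square_integrable g ->
  P.-integrable setT (EFin \o (fun w => f w * g w)).
Proof.
move=> [mf f2] [mg g2].
apply: (le_integrable _ _ _ (integrableD _ f2 g2)) => //.
  by apply/measurable_EFinP; exact: measurable_funM.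
move=> w _ /=; rewrite lee_fin [X in _ <= X]ger0_norm ?addr_ge0 ?sqr_ge0//.
rewrite normrM -(real_normK (num_real (f w))) -(real_normK (num_real (g w))).
have := sqr_ge0 (`|f w| - `|g w|); have := normr_ge0 (f w); have := normr_ge0 (g w).
nra.
Qed.

Lemma square_integrable_cst c : square_integrable (cst c).
Proof.
split => //; rewrite (_ : EFin \o _ = EFin \o cst (c ^+ 2) :> (T -> \bar R))//.
exact: finite_measure_integrable_cst.
Qed.

Lemma square_integrableD f g : square_integrable f -> square_integrable g ->
  square_integrable (fun w => f w + g w).
Proof.
move=> [mf f2] [mg g2]; split; first exact: measurable_funD.
apply: (le_integrable _ _ _ (integrableZl _ 2 (integrableD _ f2 g2))) => //.
  by apply/measurable_EFinP; apply: measurable_funX; exact: measurable_funD.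
move=> w _ /=; rewrite lee_fin [X in _ <= X]ger0_norm; last first.
  by rewrite mulr_ge0// addr_ge0 ?sqr_ge0.
rewrite ger0_norm ?sqr_ge0//.
by have := sqr_ge0 (f w - g w); nra.
Qed.

Lemma square_integrableZ c f : square_integrable f ->
  square_integrable (fun w => c * f w).
Proof.
move=> [mf f2]; split; first exact: measurable_funM.
under [X in _.-integrable _ (_ \o X)]eq_fun do rewrite exprMn.
exact: (integrableZl _ (c ^+ 2) f2).
Qed.

Lemma square_integrableB f g : square_integrable f -> square_integrable g ->
  square_integrable (fun w => f w - g w).
Proof.
move=> sf sg; under eq_fun do rewrite -[X in _ + X]mulN1r.
by apply: square_integrableD => //; exact: square_integrableZ.
Qed.

Lemma square_integrable_sum n (F : 'I_n -> T -> R) :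
  (forall i, square_integrable (F i)) ->
  square_integrable (fun w => \sum_(i < n) F i w).
Proof.
elim: n F => [F _|n IHn F sF].
  under eq_fun do rewrite big_ord0; exact: square_integrable_cst.
under eq_fun do rewrite big_ord_recr/=.
by apply: square_integrableD => //; exact: IHn.
Qed.

Lemma ae_square_integrable f g : measurable_fun setT g ->
  {ae P, forall w, f w = g w} -> square_integrable f -> square_integrable g.
Proof.
move=> mg fg [mf /integrableP[mf2 f2]]; split => //; apply/integrableP; split.
  by apply/measurable_EFinP; exact: measurable_funX.
rewrite (le_lt_trans _ f2)//; apply: ae_ge0_le_integral => //.
- by apply: measurableT_comp => //; apply/measurable_EFinP; exact: measurable_funX.
- exact: measurableT_comp.
- by apply: filterS fg => w fgw _; rewrite /= fgw.
Qed.

Lemma innerC f g : inner f g = inner g f.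
Proof. by apply: eq_Rintegral => w _; rewrite mulrC. Qed.

Lemma innerDl f g h : square_integrable f -> square_integrable g ->
  square_integrable h -> inner (fun w => f w + g w) h = inner f h + inner g h.
Proof.
move=> sf sg sh; rewrite /inner -RintegralD//; [|exact: square_integrable_mul..].
by apply: eq_Rintegral => w _; rewrite mulrDl.
Qed.

Lemma innerZl c f g : square_integrable f -> square_integrable g ->
  inner (fun w => c * f w) g = c * inner f g.
Proof.
move=> sf sg; rewrite /inner -RintegralZl//; last exact: square_integrable_mul.
by apply: eq_Rintegral => w _; rewrite mulrA.
Qed.

Lemma innerBl f g h : square_integrable f -> square_integrable g ->
  square_integrable h -> inner (fun w => f w - g w) h = inner f h - inner g h.
Proof.
move=> sf sg sh; rewrite /inner -RintegralB//; [|exact: square_integrable_mul..].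
by apply: eq_Rintegral => w _; rewrite mulrBl.
Qed.

Lemma innerBr f g h : square_integrable f -> square_integrable g ->
  square_integrable h -> inner h (fun w => f w - g w) = inner h f - inner h g.
Proof. by move=> *; rewrite innerC innerBl// !(innerC h). Qed.

Lemma inner_suml n (F : 'I_n -> T -> R) g :
  (forall i, square_integrable (F i)) -> square_integrable g ->
  inner (fun w => \sum_(i < n) F i w) g = \sum_(i < n) inner (F i) g.
Proof.
elim: n F => [F _ _|n IHn F sF sg].
  rewrite big_ord0 /inner; under eq_Rintegral do rewrite big_ord0 mul0r.
  by rewrite Rintegral_cst// mul0r.
rewrite big_ord_recr/= -IHn// -innerDl//; last exact: square_integrable_sum.
by apply: eq_Rintegral => w _; rewrite big_ord_recr.
Qed.

Lemma inner_ge0 f : 0 <= inner f f.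
Proof. by apply: Rintegral_ge0 => w _; rewrite -expr2 sqr_ge0. Qed.

Lemma inner_subsqr f g : square_integrable f -> square_integrable g ->
  inner (fun w => f w - g w) (fun w => f w - g w) =
  inner f f - 2 * inner f g + inner g g.
Proof.
move=> sf sg; have sfg := square_integrableB sf sg.
rewrite innerBl// !innerBr// (innerC g f); ring.
Qed.

Lemma inner_cauchy_schwarz f g : square_integrable f -> square_integrable g ->
  inner f g ^+ 2 <= inner f f * inner g g.
Proof.
move=> sf sg.
have key c : 0 <= inner f f - 2 * (c * inner f g) + c ^+ 2 * inner g g.
  have scg := square_integrableZ c sg.
  have := inner_ge0 (fun w => f w - c * g w).
  by rewrite inner_subsqr// (innerC f (fun w => c * g w)) !innerZl// (innerC g (fun w => c * g w)) innerZl// (innerC g f); lra.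
have := inner_ge0 g; rewrite le_eqVlt => /predU1P[g0|g0].
  have fg0 : inner f g = 0.
    apply/eqP/negPn/negP => fgN0.
    (* Degenerate case: the quadratic in [c] becomes affine, and this [c] gives it the value -1. *)
    have := key ((inner f f + 1) / (2 * inner f g)).
    rewrite -g0 mulr0 addr0 (_ : 2 * _ = inner f f + 1); last by field.
    by lra.
  by rewrite fg0 expr0n/= mulr_ge0 ?inner_ge0.
(* The minimiser of the quadratic in [c]. *)
have := key (inner f g / inner g g).
rewrite (_ : _ + _ = (inner f f * inner g g - inner f g ^+ 2) / inner g g); last first.
  by field; rewrite gt_eqF.
by rewrite pmulr_lge0 ?invr_gt0// subr_ge0.
Qed.

Lemma ae_inner f f' g : measurable_fun setT f -> measurable_fun setT f' ->
  measurable_fun setT g -> {ae P, forall w, f w = f' w} ->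
  inner f g = inner f' g.
Proof.
move=> mf mf' mg ff'; congr fine; apply: ae_eq_integral => //.
- by apply/measurable_EFinP; exact: measurable_funM.
- by apply/measurable_EFinP; exact: measurable_funM.
- by apply: filterS ff' => w -> _.
Qed.

Lemma covariance_inner f g : square_integrable f -> square_integrable g ->
  covariance P f g =
  (inner f g - inner f (cst 1) * inner g (cst 1))%:E.
Proof.
move=> sf sg; have s1 := square_integrable_cst 1.
have i1 h : square_integrable h -> P.-integrable setT (EFin \o h).
  move=> sh; have := square_integrable_mul sh s1.
  by under [X in _.-integrable _ (_ \o X)]eq_fun do rewrite mulr1.
have E h : square_integrable h -> ('E_P[h] = (inner h (cst 1))%:E)%E.
  move=> sh; rewrite unlock /inner /Rintegral fineK.
    by apply: eq_integral => w _; rewrite mulr1.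
  exact: (integrable_fin_num _ (square_integrable_mul sh s1)).
rewrite covarianceE; last 3 first.
- by apply/Lfun1_integrable; exact: i1.
- by apply/Lfun1_integrable; exact: i1.
- by apply/Lfun1_integrable; exact: square_integrable_mul.
rewrite (E f)// (E g)// -EFinM EFinB; congr (_ - _)%E.
rewrite unlock /inner /Rintegral fineK//.
exact: (integrable_fin_num _ (square_integrable_mul sf sg)).
Qed.

End square_integrable.

(** * Expectation of a product of independent variables *)

Section independence.
Context {R : realType} {d : measure_display} {T : measurableType d}.
Variable P : probability T R.

(** Independence says that the joint law and the product of the marginal laws agree on rectangles,
    hence everywhere by uniqueness of product measures; the integral of the product then factors by
    Fubini. *)
Lemma inner_independent (X Y : T -> R) :
  square_integrable P X -> square_integrable P Y ->
  (forall A B : set R, measurable A -> measurable B ->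
    P (X @^-1` A `&` Y @^-1` B) = (P (X @^-1` A) * P (Y @^-1` B))%E) ->
  inner P X Y = inner P X (cst 1) * inner P Y (cst 1).
Proof.
move=> sX sY ind.
have [mX _] := sX; have [mY _] := sY.
pose X' : {mfun T >-> R} := mfun_Sub (mem_set mX).
pose Y' : {mfun T >-> R} := mfun_Sub (mem_set mY).
have mZ : measurable_fun setT (fun w => (X w, Y w) : R * R).
  exact: measurable_fun_pair.
pose Z : {mfun T >-> (R * R)%type} := mfun_Sub (mem_set mZ).
pose f (z : R * R) := (z.1 * z.2)%:E.
have mf : measurable_fun setT f by apply/measurable_EFinP; exact: measurable_funM.
have iXY := square_integrable_mul sX sY.
have i1 h : square_integrable P h -> P.-integrable setT (EFin \o h).
  move=> sh; have := square_integrable_mul sh (square_integrable_cst P 1).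
  by under [X in _.-integrable _ (_ \o X)]eq_fun do rewrite mulr1.
have fin1 h : square_integrable P h -> (\int[P]_w (h w)%:E)%E = (inner P h (cst 1))%:E.
  move=> sh; rewrite /inner /Rintegral fineK.
    by apply: eq_integral => w _; rewrite mulr1.
  exact: (integrable_fin_num _ (square_integrable_mul sh (square_integrable_cst P 1))).
have prodE A : measurable A ->
    (distribution P X' \x distribution P Y')%E A = distribution P Z A.
  apply: product_measure_unique => A1 A2 mA1 mA2.
  by rewrite /distribution /pushforward/= -ind.
have E1 : (\int[distribution P X' \x distribution P Y']_z f z)%E = (\int[distribution P Z]_z f z)%E.
  by apply: eq_measure_integral => A mA _; exact: prodE.
have iZ : (distribution P Z).-integrable setT f.
  by apply: integrable_pushforward.
have iprod : (distribution P X' \x distribution P Y')%E.-integrable setT f.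
  apply/integrableP; split => //; case/integrableP: iZ => _ iZ'.
  by rewrite (eq_measure_integral (distribution P Z)) => [//|A mA _]; exact: prodE.
apply: EFin_inj.
rewrite /inner {1}/Rintegral fineK; last exact: integrable_fin_num.
rewrite -[LHS](@integral_distribution _ _ _ _ _ P Z f)// -E1.
rewrite -integral12_prod_meas1//.
have iY : (distribution P Y').-integrable setT EFin.
  by apply: integrable_pushforward => //; exact: i1.
have iX : (distribution P X').-integrable setT EFin.
  by apply: integrable_pushforward => //; exact: i1.
have EX : (\int[distribution P X']_x x%:E)%E = (inner P X (cst 1))%:E.
  by rewrite (@integral_distribution _ _ _ _ _ P X' EFin)//; [exact: fin1|exact: i1].
have EY : (\int[distribution P Y']_x x%:E)%E = (inner P Y (cst 1))%:E.
  by rewrite (@integral_distribution _ _ _ _ _ P Y' EFin)//; [exact: fin1|exact: i1].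
transitivity (\int[distribution P X']_x (x%:E * (inner P Y (cst 1))%:E))%E.
  apply: eq_integral => x _; rewrite /fubini_F /f/= -EY -integralZl//.
by rewrite integralZr// EX.
Qed.

End independence.

(** * Covariance of Brownian motion *)

Section brownian_moments.
Context {R : realType} {d : measure_display} {T : measurableType d}.
Variable P : probability T R.

Lemma normal_law_moments (Z : T -> R) (s : R) : s != 0 -> measurable_fun setT Z ->
  (forall A : set R, measurable A -> P (Z @^-1` A) = normal_prob 0 s A) ->
  [/\ square_integrable P Z, inner P Z Z = s ^+ 2 & inner P Z (cst 1) = 0].
Proof.
move=> s0 mZ lawZ.
have mZ' : @measurable_fun _ _ T (measurableTypeR R) setT Z by exact: mZ.
pose Z' : {mfun T >-> measurableTypeR R} :=
  @mfun_Sub _ _ T (measurableTypeR R) Z (mem_set mZ').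
have mquad c : measurable_fun setT (fun x : R => x ^+ 2 + c * x + 1).
  apply: measurable_funD => //; apply: measurable_funD; first exact: measurable_funX.
  exact: measurable_funM.
(* The integrand is nonnegative, so the transfer to the normal law needs no integrability of [Z].
   The case [c = 0] then yields square integrability, after which [c = 0] and [c = 1] can be split
   into the second moment and the mean. *)
have E c : `|c| <= 1 ->
    (\int[P]_w (Z w ^+ 2 + c * Z w + 1)%:E)%E = (s ^+ 2 + 1)%:E.
  move=> c1; rewrite -(normal_quad_integral s0 c1).
  pose g (x : R) := (x ^+ 2 + c * x + 1)%:E.
  have g0 x : (0 <= g x)%E.
    have : c ^+ 2 <= 1 by rewrite -(real_normK (num_real c)) expr_le1.
    rewrite /g lee_fin; nra.
  have mg : measurable_fun setT g by apply/measurable_EFinP; exact: mquad.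
  rewrite -[LHS](@ge0_integral_distribution _ _ _ _ _ P Z' g)//.
  by apply: eq_measure_integral => A mA _; exact: lawZ.
have sZ : square_integrable P Z.
  split => //; apply/integrableP; split.
    by apply/measurable_EFinP; exact: measurable_funX.
  apply: (@le_lt_trans _ _ (\int[P]_w (Z w ^+ 2 + 0 * Z w + 1)%:E)%E); last first.
    by rewrite E ?normr0// ltry.
  apply: ge0_le_integral => //.
  - by apply: measurableT_comp => //; apply/measurable_EFinP; exact: measurable_funX.
  - by apply/measurable_EFinP; exact: (measurableT_comp (mquad 0) mZ).
  - by move=> w _; rewrite /= lee_fin ger0_norm ?sqr_ge0// mul0r addr0 lerDl.
have s1 := square_integrable_cst P 1.
have Ec c : `|c| <= 1 -> inner P Z Z + c * inner P Z (cst 1) + 1 = s ^+ 2 + 1.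
  move=> c1; have scZ := square_integrableZ c sZ.
  have sc1 := square_integrableD scZ s1.
  have I11 : inner P (cst 1) (cst 1) = 1.
    rewrite /inner; under eq_Rintegral do rewrite mulr1.
    by rewrite Rintegral_cst//= probability_setT mulr1.
  have := innerDl scZ s1 s1; rewrite innerZl// I11 -addrA => <-.
  apply: EFin_inj; rewrite -(E c c1) /inner -RintegralD//; [|exact: square_integrable_mul..].
  rewrite /Rintegral fineK.
    by apply: eq_integral => w _; rewrite mulr1 -expr2 addrA.
  apply: integrable_fin_num => //.
  pose u w := Z w * Z w; pose v w := (c * Z w + cst 1 w) * cst 1 w.
  apply: (@integrableD _ _ _ P setT measurableT (EFin \o u) (EFin \o v));
    exact: square_integrable_mul.
have Z0 := Ec 0; have Z1 := Ec 1; rewrite normr0 in Z0; rewrite normr1 in Z1.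
have := Z0 ler01; have := Z1 (lexx _); rewrite mul0r mul1r => H1 H0.
by split => //; lra.
Qed.

Variables (F : R -> set (set T)) (B : R -> T -> R).
Hypotheses (fF : filtration F) (bB : brownian_motion P F B).

Let mFt t A : 0 <= t -> F t A -> measurable A.
Proof. by move=> t0; case: fF => _ [+ _] => /(_ t t0); apply. Qed.

Lemma adapted_measurable (Y : T -> R) t : 0 <= t -> measurable_wrt (F t) Y ->
  measurable_fun setT Y.
Proof. by move=> t0 mY _ A mA; rewrite setTI; apply: (mFt t0); exact: mY. Qed.

Let mB t : 0 <= t -> measurable_fun setT (B t).
Proof. by move=> t0; case: bB => [H _ _ _ _]; exact: adapted_measurable t0 (H t t0). Qed.

Let increment_moments s t : 0 <= s -> s < t ->
  [/\ square_integrable P (B t \- B s), inner P (B t \- B s) (B t \- B s) = t - s &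
      inner P (B t \- B s) (cst 1) = 0].
Proof.
move=> s0 st; case: bB => [_ _ _ _ law].
have st0 : 0 < Num.sqrt (t - s) by rewrite sqrtr_gt0 subr_gt0.
have mBB : measurable_fun setT (B t \- B s).
  by apply: measurable_funB; apply: mB => //; exact: ltW (le_lt_trans s0 st).
have [sB BB B1] := normal_law_moments (lt0r_neq0 st0) mBB (law s t s0 st).
by split => //; rewrite BB sqr_sqrtr// subr_ge0 ltW.
Qed.

(** The law is prescribed for increments over [s < t], and [B 0] vanishes only almost everywhere. So
    [t = 0] is treated apart, and for [t > 0] the moments are transported along the almost
    everywhere equality of [B t] with [B t - B 0]. *)
Lemma brownian_moments t : 0 <= t ->
  [/\ square_integrable P (B t), inner P (B t) (B t) = t & inner P (B t) (cst 1) = 0].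
Proof.
move=> t0; case: bB => [_ B0 _ _ _].
have m0 := mB (lexx 0); have mt := mB t0.
have mc (c : R) : measurable_fun setT (cst c : T -> R) by exact: measurable_cst.
have [->|tN0] := eqVneq t 0.
  have B0' : {ae P, forall w, cst 0 w = B 0 w} by apply: filterS B0.
  have sB0 := ae_square_integrable m0 B0' (square_integrable_cst P 0).
  split => //.
  - rewrite (ae_inner m0 (mc 0) m0 B0) /inner.
    by under eq_Rintegral do rewrite mul0r; rewrite Rintegral_cst// mul0r.
  - rewrite (ae_inner m0 (mc 0) (mc 1) B0) /inner.
    by under eq_Rintegral do rewrite mul0r; rewrite Rintegral_cst// mul0r.
have tp : 0 < t by rewrite lt_neqAle eq_sym tN0.
have [sI II I1] := increment_moments (lexx 0) tp.
have BI : {ae P, forall w, (B t \- B 0) w = B t w}.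
  by apply: filterS B0 => w /= ->; rewrite subr0.
have mI := sI.1.
split.
- exact: ae_square_integrable mt BI sI.
- by rewrite -(ae_inner mI mt mt BI) innerC -(ae_inner mI mt mI BI) II subr0.
- by rewrite -(ae_inner mI mt (mc 1) BI).
Qed.

(** [B t] splits into [B s] and an increment of mean zero that is independent of [F s], to which
    [B s] is adapted. *)
Let brownian_covariance_lt s t : 0 <= s -> s < t -> inner P (B s) (B t) = s.
Proof.
move=> s0 st; case: (bB) => [adB _ _ indB _].
have [sBs BsBs Bs1] := brownian_moments s0.
have [sBt _ Bt1] := brownian_moments (le_trans s0 (ltW st)).
have [sI _ I1] := increment_moments s0 st.
rewrite (_ : inner P (B s) (B t) = inner P (B s) (B s) + inner P (B s) (B t \- B s)); last first.
  by rewrite innerBr// addrC subrK.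
rewrite BsBs inner_independent// ?I1 ?mulr0 ?addr0// => A C mA mC.
apply: indB => //; exact: adB.
Qed.

Lemma brownian_covariance s t : 0 <= s -> 0 <= t ->
  inner P (B s) (B t) = Num.min s t.
Proof.
move=> s0 t0; have [st|ts|->] := ltgtP s t.
- exact: brownian_covariance_lt.
- by rewrite innerC brownian_covariance_lt.
- by case: (brownian_moments t0).
Qed.

Lemma brownian_independent_inner (X0 : T -> R) t : 0 <= t ->
  square_integrable P X0 -> indep_rv_process P X0 B -> inner P X0 (B t) = 0.
Proof.
move=> t0 sX ind; have [sB _ B1] := brownian_moments t0.
rewrite inner_independent// ?B1 ?mulr0// => A C mA mC.
have := ind 1%N (fun _ => t) (fun _ => C) A (fun _ => t0) (fun _ => mC) mA.
have -> // : \bigcap_(i in [set: 'I_1]) (B t @^-1` C) = B t @^-1` C.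
by apply: bigcap_const; exists ord0.
Qed.

End brownian_moments.

(** * Mean square limits *)

Section mean_square_limit.
Context {R : realType} {d : measure_display} {T : measurableType d}.
Variable P : probability T R.

Lemma limn_einf_le (u : (\bar R)^nat) (M : \bar R) N :
  (forall n, (N <= n)%N -> (u n <= M)%E) -> (limn_einf u <= M)%E.
Proof.
move=> uM; rewrite limn_einf_lim; apply: lime_le; first exact: is_cvg_einfs.
apply: nearW => n; apply: (@le_trans _ _ (u (maxn n N))).
  by apply: ereal_inf_lbound; exists (maxn n N) => //=; exact: leq_maxl.
by apply: uM; exact: leq_maxr.
Qed.

Variables (Y_ : nat -> T -> R) (Y : T -> R).
Hypotheses (sY_ : forall n, square_integrable P (Y_ n)) (mY : measurable_fun setT Y).
Hypothesis Ycvg : {ae P, forall w, Y_ ^~ w @ \oo --> Y w}.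

(** Fatou in the index [m], outside a null set where convergence may fail. The conclusion is stated
    in the extended reals because [Y] is not yet known to be square integrable. *)
Lemma fatou_mean_square n N (e : R) :
  (forall m, (N <= m)%N -> inner P (Y_ n \- Y_ m) (Y_ n \- Y_ m) <= e) ->
  (\int[P]_w ((Y_ n w - Y w) ^+ 2)%:E <= e%:E)%E.
Proof.
move=> He; have [Z [mZ Z0 ZN]] := Ycvg.
have mYn := (sY_ n).1.
have msq m : measurable_fun setT (fun w => ((Y_ n w - Y_ m w) ^+ 2)%:E).
  apply/measurable_EFinP; apply: measurable_funX; apply: measurable_funB => //.
  exact: (sY_ m).1.
have msqY : measurable_fun setT (fun w => ((Y_ n w - Y w) ^+ 2)%:E).
  by apply/measurable_EFinP; apply: measurable_funX; exact: measurable_funB.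
have sqr_ge0' (f : T -> R) : forall w, setT w -> (0 <= (f w ^+ 2)%:E)%E.
  by move=> w _; rewrite lee_fin sqr_ge0.
rewrite (ge0_negligible_integral mZ)//; last by move=> w _; rewrite lee_fin sqr_ge0.
have mZC : measurable (setT `\` Z) by exact: measurableD.
pose f m w := ((Y_ n w - Y_ m w) ^+ 2)%:E.
apply: (@le_trans _ _ (\int[P]_(w in setT `\` Z) limn_einf (f ^~ w))%E).
  rewrite le_eqVlt; apply/orP; left; apply/eqP; apply: eq_integral => w.
  rewrite inE => -[_ nZw].
  have cw : Y_ ^~ w @ \oo --> Y w by apply: contrapT => nc; apply: nZw; exact: ZN.
  have cf : f ^~ w @ \oo --> ((Y_ n w - Y w) ^+ 2)%:E.
    have c : Y_ n w - Y_ m w @[m --> \oo] --> Y_ n w - Y w.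
      by apply: cvgB => //; exact: cvg_cst.
    apply: cvg_EFin; first exact: nearW.
    exact: (cvg_comp _ (fun x : R => x ^+ 2) c (@sqr_continuous R _)).
  rewrite is_cvg_limn_einfE; last by apply/cvg_ex; eexists; exact: cf.
  by apply/esym/cvg_lim.
apply: (le_trans (fatou _ mZC _ _)).
- by move=> m; exact: measurable_funTS (msq m).
- by move=> m w _; rewrite lee_fin sqr_ge0.
apply: (limn_einf_le (N := N)) => m /He Hm.
rewrite (_ : (\int[P]_(x in setT `\` Z) f m x)%E = (inner P (Y_ n \- Y_ m) (Y_ n \- Y_ m))%:E).
  by rewrite lee_fin.
have sB := square_integrableB (sY_ n) (sY_ m).
rewrite /f -ge0_negligible_integral//; last by move=> w _; rewrite lee_fin sqr_ge0.
rewrite /inner /Rintegral fineK; first by apply: eq_integral => w _.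
exact: (integrable_fin_num _ (square_integrable_mul sB sB)).
Qed.

(** No completeness of L^2 is invoked: the limit [Y] is given pointwise, and Fatou upgrades the
    Cauchy property to convergence towards it. Square integrability follows from
    [Y = Y_ N - (Y_ N - Y)]. *)
Lemma mean_square_limit :
  (forall e, 0 < e -> exists N, forall n m, (N <= n)%N -> (N <= m)%N ->
     inner P (Y_ n \- Y_ m) (Y_ n \- Y_ m) <= e) ->
  square_integrable P Y /\
  inner P (Y_ n \- Y) (Y_ n \- Y) @[n --> \oo] --> (0 : R).
Proof.
move=> cauchy.
have msq n : measurable_fun setT (fun w => (Y_ n w - Y w) ^+ 2).
  by apply: measurable_funX; apply: measurable_funB => //; exact: (sY_ n).1.
have bnd e : 0 < e -> exists N, forall n, (N <= n)%N ->
    (\int[P]_w ((Y_ n w - Y w) ^+ 2)%:E <= e%:E)%E.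
  move=> /cauchy[N HN]; exists N => n Nn; apply: (@fatou_mean_square n N) => m Nm.
  exact: HN.
have sB n : (\int[P]_w ((Y_ n w - Y w) ^+ 2)%:E < +oo)%E ->
    square_integrable P (Y_ n \- Y).
  move=> fin; split; first by apply: measurable_funB => //; exact: (sY_ n).1.
  apply/integrableP; split; first exact/measurable_EFinP/msq.
  by under eq_integral do rewrite /= ger0_norm ?sqr_ge0//.
have sY : square_integrable P Y.
  have [N HN] := bnd 1 ltr01.
  have := square_integrableB (sY_ N) (sB N (le_lt_trans (HN N (leqnn _)) (ltry _))).
  by under eq_fun do rewrite /= subKr.
split => //; apply/cvgr0Pnorm_le => e e0.
have [N HN] := bnd e e0; exists N => // n Nn.
rewrite ger0_norm ?inner_ge0// -lee_fin (le_trans _ (HN n Nn))//.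
have sYn := square_integrableB (sY_ n) sY.
rewrite le_eqVlt; apply/orP; left; apply/eqP.
rewrite /inner /Rintegral fineK; first by apply: eq_integral => w _.
exact: (integrable_fin_num _ (square_integrable_mul sYn sYn)).
Qed.

Lemma inner_mean_square_cvg (Z_ : nat -> T -> R) (Z : T -> R) :
  square_integrable P Y -> (forall n, square_integrable P (Z_ n)) ->
  square_integrable P Z ->
  inner P (Y_ n \- Y) (Y_ n \- Y) @[n --> \oo] --> (0 : R) ->
  inner P (Z_ n \- Z) (Z_ n \- Z) @[n --> \oo] --> (0 : R) ->
  inner P (Y_ n) (Z_ n) @[n --> \oo] --> inner P Y Z.
Proof.
move=> sY sZ_ sZ Y0 Z0.
have sYB n := square_integrableB (sY_ n) sY.
have sZB n := square_integrableB (sZ_ n) sZ.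
have cs0 (f g : nat -> T -> R) : (forall n, square_integrable P (f n)) ->
    (forall n, square_integrable P (g n)) ->
    inner P (f n) (f n) * inner P (g n) (g n) @[n --> \oo] --> (0 : R) ->
    inner P (f n) (g n) @[n --> \oo] --> (0 : R).
  move=> sf sg fg0; apply/cvgr0Pnorm_lt => e e0.
  have e20 : 0 < e ^+ 2 by rewrite exprn_gt0.
  have [N _ HN] := (cvgr0Pnorm_lt _).1 fg0 _ e20.
  exists N => // n Nn; have := HN n Nn.
  rewrite ger0_norm ?mulr_ge0 ?inner_ge0// => /(le_lt_trans (inner_cauchy_schwarz (sf n) (sg n))).
  by rewrite -(real_normK (num_real (inner _ _ _))) ltr_pXn2r// nnegrE ltW.
rewrite (_ : (fun n => _) = (fun n => inner P (Y_ n \- Y) (Z_ n \- Z) +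
    inner P (Y_ n \- Y) Z + inner P Y (Z_ n \- Z) + inner P Y Z)); last first.
  apply/funext => n.
  rewrite (innerBr (sZ_ n) sZ (sYB n)) (innerBr (sZ_ n) sZ sY).
  rewrite (innerBl (sY_ n) sY (sZ_ n)) (innerBl (sY_ n) sY sZ); ring.
rewrite -[X in _ --> X]add0r -[X in _ --> X + _]addr0 -[X in _ --> X + _ + _]addr0.
apply: cvgD; last exact: cvg_cst.
apply: cvgD; first apply: cvgD.
- apply: cs0 => //; rewrite -[X in _ --> X](mulr0 0); exact: cvgM.
- apply: (cs0 _ (fun _ => Z)) => //; rewrite -[X in _ --> X](mul0r (inner P Z Z)).
  by apply: cvgM => //; exact: cvg_cst.
- apply: (cs0 (fun _ => Y)) => //; rewrite -[X in _ --> X](mulr0 (inner P Y Y)).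
  by apply: cvgM => //; exact: cvg_cst.
Qed.

End mean_square_limit.

(** * Riemann sums *)

Section riemann_sums.
Context {R : realType}.
Notation mu := (@lebesgue_measure R).

Lemma Rintegral_sum d (T : measurableType d) (m : {measure set T -> \bar R})
    (D : set T) n (F : 'I_n -> T -> R) : measurable D ->
  (forall i, m.-integrable D (EFin \o F i)) ->
  m.-integrable D (EFin \o (fun x => \sum_(i < n) F i x)) /\
  \int[m]_(x in D) (\sum_(i < n) F i x) = \sum_(i < n) \int[m]_(x in D) F i x.
Proof.
move=> mD; elim: n F => [F _|n IHn F iF].
  split; first by under eq_fun do rewrite big_ord0; exact: integrable0.
  by under eq_Rintegral do rewrite big_ord0; rewrite big_ord0 /Rintegral integral0.
have [i1 E1] := IHn (fun i => F (widen_ord (leqnSn n) i)) (fun i => iF _).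
rewrite big_ord_recr/= -E1; split.
  under eq_fun do rewrite big_ord_recr/=.
  exact: (integrableD mD i1 (iF ord_max)).
by rewrite -RintegralD//; apply: eq_Rintegral => x _; rewrite big_ord_recr.
Qed.

Lemma dominated_convergence_R (D : set R) (f_ : nat -> R -> R) (f : R -> R) (M : R) :
  measurable D -> (mu D < +oo)%E ->
  (forall n, measurable_fun D (f_ n)) -> measurable_fun D f ->
  {ae mu, forall x, D x -> f_ ^~ x @ \oo --> f x} ->
  (forall n x, D x -> `|f_ n x| <= M) ->
  [/\ mu.-integrable D (EFin \o f),
      \int[mu]_(x in D) `|f_ n x - f x| @[n --> \oo] --> (0 : R) &
      \int[mu]_(x in D) f_ n x @[n --> \oo] --> \int[mu]_(x in D) f x].
Proof.
move=> mD Dfin mf_ mf ff fM.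
have icst : mu.-integrable D (EFin \o cst M).
  apply/integrableP; split; first exact/measurable_EFinP.
  rewrite /= (_ : (fun x => _) = cst `|M|%:E)// integral_cst//.
  by rewrite lte_mul_pinfty.
have h1 n : measurable_fun D (EFin \o f_ n) by apply/measurable_EFinP.
have h2 : measurable_fun D (EFin \o f) by exact/measurable_EFinP.
have h3 : {ae mu, forall x, D x -> (EFin \o f_ n) x @[n --> \oo] --> (EFin \o f) x}.
  apply: filterS ff; first exact: (ae_filter_ringOfSetsType mu).
  by move=> x fx Dx; apply: cvg_EFin; [exact: nearW|exact: fx].
have h4 : {ae mu, forall x n, D x -> (`|(EFin \o f_ n) x| <= (EFin \o cst M) x)%E}.
  by apply: aeW => x n Dx; rewrite /= lee_fin fM.
have [i0 i1 i2] := @dominated_convergence _ _ R mu D mD (fun n => EFin \o f_ n) (EFin \o f)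
  (EFin \o cst M) h1 h2 h3 icst h4.
split => //; first exact: fine_cvg.
by apply: fine_cvg; rewrite fineK//; exact: integrable_fin_num.
Qed.

Variables (h : R -> R) (s M e : R).
Hypotheses (s0 : 0 < s) (mh : measurable_fun setT h).
Hypothesis hM : forall u, 0 <= u <= s -> `|h u| <= M.
Hypothesis hc : forall u, u != e -> {for u, continuous h}.

Let grid (n i : nat) : R := s * i%:R / n.+1%:R.

Let g (n : nat) (u : R) : R :=
  \sum_(i < n.+1) h (grid n i) * \1_(`[grid n i, grid n i.+1[%classic) u.

Let n0 (n : nat) : 0 < n.+1%:R :> R. Proof. by rewrite ltr0n. Qed.

Let gridS n i : grid n i.+1 - grid n i = s / n.+1%:R.
Proof. by rewrite /grid -mulrBl -mulrBr -natrB// subSnn mulr1. Qed.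

Let grid_ge0 n i : 0 <= grid n i.
Proof. by rewrite /grid divr_ge0// mulr_ge0// ltW. Qed.

Let grid_les n i : (i <= n.+1)%N -> grid n i <= s.
Proof. by move=> ilen; rewrite /grid ler_pdivrMr// ler_pM2l// ler_nat. Qed.

Let gridlt n i : grid n i < grid n i.+1.
Proof. by rewrite -subr_gt0 gridS divr_gt0. Qed.

(** The half-open cells partition [0, s[, and the cell of [u] has index the integer part of
    [u * n.+1 / s]; [v] is its left end. *)
Let gE n u : 0 <= u < s ->
  exists2 v, g n u = h v & (0 <= v <= s) && (`|u - v| <= s / n.+1%:R).
Proof.
move=> /andP[u0 us].
pose j := Num.truncn (u * n.+1%:R / s).
have x0 : 0 <= u * n.+1%:R / s by rewrite divr_ge0 ?mulr_ge0// ltW.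
have jE (i : nat) : (u \in `[grid n i, grid n i.+1[) = (i == j).
  rewrite eq_sym truncn_eq// in_itv/= /grid !ler_pdivlMr// !ler_pdivrMr// !ltr_pdivlMr// !ltr_pdivrMr//.
  by rewrite ![_ * s]mulrC.
have jn : (j < n.+1)%N.
  by rewrite truncn_lt_nat// ltr_pdivrMr// mulrC ltr_pM2l.
have := jE j; rewrite eqxx in_itv/= => /andP[gu ug].
exists (grid n j).
  rewrite /g (bigD1 (Ordinal jn))//= big1 ?addr0; last first.
    move=> i ij; rewrite indicE mem_setE jE (_ : _ == _ = false) ?mulr0//.
    by apply: contra_neqF ij => /eqP ij; exact/val_inj.
  by rewrite indicE mem_setE jE eqxx mulr1.
rewrite grid_ge0 grid_les ?(ltnW jn)//= ger0_norm ?subr_ge0//.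
by rewrite -(gridS n j) lerD2r ltW.
Qed.

Let mg n : measurable_fun setT (g n).
Proof.
apply: measurable_sum => i; apply: measurable_funM => //.
Qed.

Let g_integral n : \int[mu]_(u in `[0, s]) g n u =
  s / n.+1%:R * \sum_(i < n.+1) h (grid n i).
Proof.
have Ai i : (i < n.+1)%N -> `[grid n i, grid n i.+1[%classic `&` `[0, s]%classic = `[grid n i, grid n i.+1[%classic.
  move=> ilt; apply/setIidPl => u /=; rewrite !in_itv/= => /andP[u1 u2].
  by rewrite (le_trans (grid_ge0 n i) u1)/= (le_trans (ltW u2))// grid_les.
have iind (A : set R) : measurable A -> mu.-integrable `[0, s] (EFin \o \1_A).
  move=> mA; apply: measurable_bounded_integrable => //.
    by rewrite /= lebesgue_measure_itv/= lte_fin s0 -EFinD ltry.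
  exists 1; split => // y y1 x _ /=; rewrite indicE ger0_norm//.
  by rewrite (le_trans _ (ltW y1))// lern1 leq_b1.
have [|_ ->] := @Rintegral_sum _ _ mu `[0, s]%classic _
   (fun (i : 'I_n.+1) u => h (grid n i) * \1_(`[grid n i, grid n i.+1[%classic) u) (measurable_itv _).
  by move=> i; apply: (integrableZl _ (h (grid n i)) (iind _ _)).
rewrite mulr_sumr; apply: eq_bigr => i _.
rewrite RintegralZl//; last exact: iind.
rewrite mulrC; congr (_ * _).
rewrite /Rintegral integral_indic//= Ai//= lebesgue_measure_itv/= lte_fin gridlt.
by rewrite -EFinD/= gridS.
Qed.

(** The sums are integrals of the step functions [g n], and dominated convergence applies. One
    discontinuity [e] is allowed because the integrand [rho (s - u) * below x u] jumps at [u = x];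
    together with the end point [s], which lies in no cell, it forms a null set. *)
Lemma riemann_sum_cvg :
  s / n.+1%:R * \sum_(i < n.+1) h (s * i%:R / n.+1%:R) @[n --> \oo] -->
  \int[mu]_(u in `[0, s]) h u.
Proof.
have M0 : 0 <= M by rewrite (le_trans _ (hM (u := 0) _))// lexx ltW.
rewrite (_ : (fun n => _) = (fun n => \int[mu]_(u in `[0, s]) g n u)); last first.
  by apply/funext => n; rewrite g_integral.
have [] := @dominated_convergence_R `[0, s]%classic g h M => //.
- by rewrite /= lebesgue_measure_itv/= lte_fin s0 -EFinD ltry.
- by move=> n; exact: measurable_funTS.
- exact: measurable_funTS.
- exists [set e; s]; split.
  + by apply: measurableU.
  + by apply: countable_lebesgue_measure0; exact/finite_set_countable.
  + move=> u /= nu; apply: contrapT => /not_orP[ue us]; apply: nu.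
    rewrite in_itv/= => /andP[u0 us'].
    have {us us'} us : u < s by rewrite lt_neqAle us' andbT; exact/eqP.
    have cu : {for u, continuous h} by apply: hc; exact/eqP.
    apply/cvgrPdist_lt => eps eps0.
    have /cvgrPdist_lt /(_ _ eps0) /nbhs_ballP := cu; move=> [del /= del0 Hdel].
    have : s * n.+1%:R^-1 @[n --> \oo] --> s * 0.
      by apply: cvgM; [exact: cvg_cst|exact: cvg_harmonic].
    rewrite mulr0 => /cvgr0Pnorm_lt /(_ _ del0) [N _ HN].
    exists N => // n Nn.
    have [v -> /andP[_ uv]] := gE n (introT andP (conj u0 us)).
    apply: Hdel; rewrite /ball/= (le_lt_trans uv)//.
    by rewrite (le_lt_trans (ler_norm _))// HN.
- move=> n u; rewrite /= in_itv/= => /andP[u0]; rewrite le_eqVlt => /predU1P[->|us].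
    rewrite /g big1 ?normr0// => i _; rewrite indicE mem_setE in_itv/=.
    have -> : (s < grid n i.+1) = false by apply/negbTE; rewrite -leNgt grid_les.
    by rewrite andbF mulr0.
  by have [v -> /andP[vs _]] := gE n (introT andP (conj u0 us)); exact: hM.
Qed.

End riemann_sums.

(** * Discretized Wiener integrals *)

Section wiener_sums.
Context {R : realType}.
Notation mu := (@lebesgue_measure R).

(** Deterministic counterpart of [B u]: as functions of [x], [below ^~ u] and [below ^~ v] have
    inner product [min u v] on a long enough segment [0, t]. As a function of [u] it takes the place
    of a path in [wiener_sum]. *)
Definition below (x u : R) : R := (x < u)%R%:R.

Lemma belowE u : below ^~ u = \1_(`]-oo, u[%classic) :> (R -> R).
Proof. by apply/funext => x; rewrite /below indicE mem_setE in_itv. Qed.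

Lemma measurable_below u : measurable_fun setT (below ^~ u).
Proof. by rewrite belowE; exact: measurable_indic. Qed.

Lemma below_integrable D u : measurable D -> (mu D < +oo)%E ->
  mu.-integrable D (EFin \o below ^~ u).
Proof.
move=> mD Dfin; apply: measurable_bounded_integrable => //.
  by apply: measurable_funTS; exact: measurable_below.
exists 1; split => // y y1 x _ /=; rewrite ger0_norm//.
by rewrite (le_trans _ (ltW y1))// lern1 leq_b1.
Qed.

Let itv_fin (a b : R) : (mu `[a, b]%classic < +oo)%E.
Proof. by rewrite lebesgue_measure_itv/=; case: ifP => _; rewrite ?ltry// -EFinD ltry. Qed.

Lemma Rintegral_below (t u : R) : 0 <= u <= t ->
  \int[mu]_(x in `[0, t]) below x u = u.
Proof.
move=> /andP[u0 ut]; under eq_Rintegral do rewrite (congr1 (@^~ _) (belowE u)).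
rewrite /Rintegral integral_indic//=.
rewrite (_ : _ `&` _ = `[0, u[%classic).
  rewrite lebesgue_measure_itv/= lte_fin.
  by case: (ltgtP 0 u) u0 => //= _ _; rewrite subr0.
apply/seteqP; split => x /=; rewrite !in_itv/=.
  by move=> [xu /andP[-> _]].
by move=> /andP[x0 xu]; rewrite xu x0 (le_trans (ltW xu)).
Qed.

(** A product of two indicators is [below x] at the minimum of the nodes. The right-hand side is
    also the second moment of the same combinations of Brownian values. *)
Lemma step_sum_inner (t : R) n m (c p : 'I_n -> R) (c' p' : 'I_m -> R) :
  (forall i, 0 <= p i <= t) -> (forall j, 0 <= p' j <= t) ->
  \int[mu]_(x in `[0, t]) ((\sum_i c i * below x (p i)) * (\sum_j c' j * below x (p' j))) =
  \sum_i \sum_j c i * c' j * Num.min (p i) (p' j).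
Proof.
move=> pt p't.
pose F i x := \sum_j c i * c' j * below x (Num.min (p i) (p' j)).
have min_t i j : 0 <= Num.min (p i) (p' j) <= t.
  have /andP[a1 a2] := pt i; have /andP[b1 b2] := p't j.
  by rewrite le_min a1 b1/= ge_min a2.
have ib i j : mu.-integrable `[0, t] (EFin \o (fun x => c i * c' j * below x (Num.min (p i) (p' j)))).
  by apply: (integrableZl _ (c i * c' j) (below_integrable _ _ (itv_fin _ _))).
have FE i := @Rintegral_sum _ _ _ mu `[0, t]%classic m
  (fun j x => c i * c' j * below x (Num.min (p i) (p' j))) (measurable_itv _) (ib i).
have [_ E] := @Rintegral_sum _ _ _ mu `[0, t]%classic n F (measurable_itv _) (fun i => (FE i).1).
transitivity (\int[mu]_(x in `[0, t]) (\sum_i F i x)).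
  apply: eq_Rintegral => x _; rewrite mulr_suml; apply: eq_bigr => i _.
  rewrite mulr_sumr; apply: eq_bigr => j _.
  rewrite mulrACA; congr (_ * _).
  by rewrite /below lt_min -natrM mulnb.
rewrite E; apply: eq_bigr => i _; rewrite (FE i).2; apply: eq_bigr => j _.
by rewrite RintegralZl ?Rintegral_below//; exact: below_integrable.
Qed.

Variable rho : R -> R.
Hypothesis crho : continuous rho.

(* For [phi = B ^~ w] these are Riemann sums of [B s + \int_0^s rho (s - u) * B u du], the
   integration by parts form of the Wiener integral [\int_0^s r (s - u) dB u], [r' = rho]. *)
Definition wiener_sum (s : R) (n : nat) (phi : R -> R) : R :=
  phi s + s / n.+1%:R *
    \sum_(i < n.+1) rho (s - s * i%:R / n.+1%:R) * phi (s * i%:R / n.+1%:R).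

(** The extra index [n.+1] carries the isolated term [phi s]: its node is [s] and its weight 1. *)
Let weight s (n i : nat) : R :=
  if (i < n.+1)%N then s / n.+1%:R * rho (s - s * i%:R / n.+1%:R) else 1.

Let node s (n i : nat) : R := s * i%:R / n.+1%:R.

(** Coefficients and nodes are chosen before [phi], so the same ones serve for a Brownian path and
    for [below x]. *)
Lemma wiener_sum_steps s n : exists c p : 'I_n.+2 -> R,
  (0 <= s -> forall i, 0 <= p i <= s) /\
  forall phi, wiener_sum s n phi = \sum_i c i * phi (p i).
Proof.
exists (fun i => weight s n i), (fun i => node s n i); split.
  move=> s0 i; rewrite /node divr_ge0 ?mulr_ge0//=.
  by rewrite ler_pdivrMr ?ltr0n// ler_wpM2l// ler_nat -ltnS.
move=> phi; rewrite /wiener_sum [in RHS]big_ord_recr addrC.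
rewrite -[RHS]/(_ + weight s n n.+1 * phi (node s n n.+1)).
rewrite {2}/weight ltnn mul1r {2}/node mulfK ?pnatr_eq0//; congr (_ + _).
by rewrite mulr_sumr; apply: eq_bigr => i _; rewrite /weight/= ltn_ord mulrA.
Qed.

Lemma wiener_sum_cvg (s : R) (phi : R -> R) (e : R) : 0 < s -> measurable_fun setT phi ->
  (exists M, forall u, 0 <= u <= s -> `|phi u| <= M) ->
  (forall u, u != e -> {for u, continuous phi}) ->
  wiener_sum s n phi @[n --> \oo] -->
    phi s + \int[mu]_(u in `[0, s]) (rho (s - u) * phi u).
Proof.
move=> s0 mphi [M HM] cphi.
have crs : continuous (fun u => rho (s - u)).
  by apply: continuous_compR => //; exact: continuous_subl.
have [N N0 HN] := bounded_on_segment 0 s crs.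
apply: cvgD; first exact: cvg_cst.
apply: (@riemann_sum_cvg R (fun u => rho (s - u) * phi u) s (N * M) e) => //.
- by apply: measurable_funM => //; exact: continuous_measurable_fun.
- by move=> u us; rewrite normrM ler_pM ?HM// HN// in_itv.
- by move=> u ue; apply: cvgM; [exact: crs|exact: cphi].
Qed.

(** Uniform in both [n] and [x], as a dominating constant must be: 1 bounds the isolated term, and
    [s * N] bounds [s] times an average of [n.+1] values of size at most [N]. *)
Lemma wiener_sum_below_bounded s : 0 < s ->
  exists M, forall n x, `|wiener_sum s n (below x)| <= M.
Proof.
move=> s0; have [N N0 HN] := bounded_on_segment 0 s crho.
exists (1 + s * N) => n x.
have b1 u : `|below x u| <= 1 by rewrite ger0_norm// lern1 leq_b1.
rewrite (le_trans (ler_normD _ _))// lerD//.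
rewrite normrM ger0_norm; last by rewrite divr_ge0// ltW.
rewrite -mulrA ler_pM2l// mulrC ler_pdivrMr ?ltr0n//.
rewrite (le_trans (ler_norm_sum _ _ _))//.
apply: (@le_trans _ _ (\sum_(i < n.+1) N)); last by rewrite sumr_const card_ord mulr_natr.
apply: ler_sum => i _; rewrite normrM -[leRHS]mulr1 ler_pM// HN//.
rewrite in_itv/=; apply/andP; split.
  by rewrite subr_ge0 ler_pdivrMr ?ltr0n// ler_pM2l// ler_nat ltnW.
by rewrite gerBl divr_ge0 ?mulr_ge0// ltW.
Qed.

Lemma measurable_wiener_sum_below s n :
  measurable_fun setT (fun x => wiener_sum s n (below x)).
Proof.
apply: measurable_funD; first exact: measurable_below.
apply: measurable_funM => //; apply: measurable_sum => i.
by apply: measurable_funM => //; exact: measurable_below.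
Qed.

Variable r : R -> R.
Hypotheses (cr : continuous r) (r0 : r 0 = 1).
Hypothesis dr : forall t : R, 0 < t -> is_derive t (1 : R) r (rho t).

Definition wiener_kernel (s x : R) : R := below x s * r (s - x).

Lemma measurable_wiener_kernel s : measurable_fun setT (wiener_kernel s).
Proof.
apply: measurable_funM; first exact: measurable_below.
apply: continuous_measurable_fun; apply: continuous_compR => //.
exact: continuous_subl.
Qed.

Lemma wiener_kernel_bounded s : exists M, forall x, 0 <= x -> `|wiener_kernel s x| <= M.
Proof.
have [N N0 HN] := bounded_on_segment 0 s cr.
exists N => x x0; rewrite /wiener_kernel /below.
have [xs|_] := ltP x s; last by rewrite mul0r normr0 ltW.
by rewrite mul1r HN// in_itv/= subr_ge0 (ltW xs)/= gerBl.
Qed.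

Lemma resolvent_increment s x : x < s ->
  \int[mu]_(u in `[x, s]) rho (s - u) = r (s - x) - 1.
Proof.
move=> xs; have csub := @continuous_subl R s.
have crs : continuous (fun u => rho (s - u)) by exact: continuous_compR.
have cF : continuous (fun u => - r (s - u)).
  by move=> y; apply: cvgN; exact: (continuous_compR cr csub).
have dF (u : R) : u < s -> is_derive u (1 : R) (fun u => - r (s - u)) (rho (s - u)).
  move=> us; have d1 : is_derive (s - u) (1 : R) r (rho (s - u)).
    by apply: dr; rewrite subr_gt0.
  have d2 : is_derive u (1 : R) (fun u => s - u) (- 1).
    by apply: is_derive_eq; rewrite add0r mul1r.
  have d3 := @is_derive1_comp R r (fun u => s - u) u _ _ d1 d2.
  by apply: is_derive_eq; rewrite mulrN1 opprK.
have LR : derivable_oo_LRcontinuous (fun u => - r (s - u)) x s.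
  split.
  - by move=> u; rewrite in_itv/= => /andP[_ us]; have := dF u us => ?; exact: ex_derive.
  - by apply: cvg_at_right_filter; exact: cF.
  - by apply: cvg_at_left_filter; exact: cF.
have F' : {in `]x, s[, ((fun u => - r (s - u))^`())%classic =1 (fun u => rho (s - u))}.
  move=> u; rewrite in_itv/= => /andP[_ us]; rewrite derive1E.
  by have := dF u us => ?; exact: derive_val.
rewrite /Rintegral (continuous_FTC2 xs (continuous_subspaceT crs) LR F')/=.
by rewrite subrr r0; lra.
Qed.

(** For [x < s] the limit is 1 plus the integral of [rho (s - u)] over [x, s], that is [r (s - x)]
    because [r 0 = 1]; for [x >= s] both terms vanish. This is why Riemann sums written with [rho]
    produce the kernel [r]. *)
Lemma wiener_sum_below_cvg s x : 0 < s -> 0 <= x ->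
  wiener_sum s n (below x) @[n --> \oo] --> wiener_kernel s x.
Proof.
move=> s0 x0.
have crs : continuous (fun u => rho (s - u)).
  by apply: continuous_compR => //; exact: continuous_subl.
suff -> : wiener_kernel s x =
    below x s + \int[mu]_(u in `[0, s]) (rho (s - u) * below x u).
  apply: (wiener_sum_cvg s0 (e := x)).
  - rewrite (_ : below x = \1_(`]x, +oo[%classic)); first exact: measurable_indic.
    by apply/funext => u; rewrite /below indicE mem_setE in_itv/= andbT.
  - by exists 1 => u _; rewrite ger0_norm// lern1 leq_b1.
  - move=> u ux; case: (ltgtP u x) ux => // [ux _|xu _].
    + apply: cvg_near_cst; near=> v; rewrite /below [in RHS]ltNge (ltW ux)/= ltNge ltW//.
      near: v; exact: lt_nbhsl.
    + apply: cvg_near_cst; near=> v; rewrite /below [in RHS]xu.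
      by have -> : x < v by near: v; exact: lt_nbhsr.
have E : \int[mu]_(u in `[0, s]) (rho (s - u) * below x u) =
    \int[mu]_(u in `[0, s] `&` `]x, +oo[) rho (s - u).
  rewrite Rintegral_mkcondr; apply: eq_Rintegral => u _.
  rewrite patchE mem_setE in_itv/= andbT /below.
  by case: (x < u); rewrite ?mulr1 ?mulr0.
rewrite E /wiener_kernel /below; have [xs|sx] := ltP x s; last first.
  rewrite mul0r add0r (_ : _ `&` _ = set0) ?Rintegral_set0//.
  rewrite -subset0 => u /=; rewrite !in_itv/= andbT => -[/andP[_ us] xu].
  by have := lt_le_trans xu us; rewrite ltNge sx.
rewrite mul1r (_ : _ `&` _ = `]x, s]%classic); last first.
  apply/seteqP; split => u /=; rewrite !in_itv/= andbT.
    by move=> [/andP[_ ->] ->].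
  by move=> /andP[xu ->]; rewrite xu (le_trans x0 (ltW xu)).
rewrite Rintegral_itv_obnd_cbnd; last first.
  apply: (@integrableS _ _ _ mu `[x, s]%classic `]x, s]%classic) => //.
    exact: subset_itv_oc_cc.
  exact: continuous_integrable.
by rewrite resolvent_increment//=; lra.
Unshelve. all: by end_near. Qed.

End wiener_sums.

(** * Mean square limits of the Riemann sums: isometry and orthogonality *)

Section wiener_integral.
Context {R : realType} {d : measure_display} {T : measurableType d}.
Notation mu := (@lebesgue_measure R).
Variables (P : probability T R) (F : R -> set (set T)) (B : R -> T -> R).
Hypotheses (fF : filtration F) (bB : brownian_motion P F B).
Variables (rho r : R -> R).
Hypotheses (crho : continuous rho) (cr : continuous r) (r0 : r 0 = 1).
Hypothesis dr : forall t : R, 0 < t -> is_derive t (1 : R) r (rho t).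

Let W s n w := wiener_sum rho s n (B ^~ w).
Let f s n x := wiener_sum rho s n (below x).

Let WE s n : exists c p : 'I_n.+2 -> R,
  [/\ 0 <= s -> forall i, 0 <= p i <= s,
      W s n = (fun w => \sum_i c i * B (p i) w) &
      forall x, f s n x = \sum_i c i * below x (p i)].
Proof.
have [c [p [pE cpE]]] := wiener_sum_steps rho s n.
exists c, p; split => //; first by apply: funext => w; rewrite /W cpE.
by move=> x; rewrite /f cpE.
Qed.

Let sB t : 0 <= t -> square_integrable P (B t).
Proof. by move=> t0; case: (brownian_moments fF bB t0). Qed.

Let sW s n : 0 <= s -> square_integrable P (W s n).
Proof.
move=> s0; have [c [p [/(_ s0) pE -> _]]] := WE s n.
apply: square_integrable_sum => i; apply: square_integrableZ; apply: sB.
by case/andP: (pE i).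
Qed.

Let inner_W g s n : 0 <= s -> square_integrable P g ->
  (forall t, 0 <= t -> inner P (B t) g = 0) -> inner P (W s n) g = 0.
Proof.
move=> s0 sg Bg; have [c [p [/(_ s0) pE -> _]]] := WE s n.
have p0 i : 0 <= p i by case/andP: (pE i).
rewrite inner_suml//; last by move=> i; apply: square_integrableZ; exact: sB.
by rewrite big1// => i _; rewrite innerZl ?Bg ?mulr0//; exact: sB.
Qed.

(** Both sides expand to the same double sum of coefficients times the minimum of the nodes. The
    common horizon [t] allows two different times [s] and [s']. *)
Let wiener_sum_isometry t s s' n m : 0 <= s <= t -> 0 <= s' <= t ->
  inner P (W s n) (W s' m) = \int[mu]_(x in `[0, t]) (f s n x * f s' m x).
Proof.
move=> /andP[s0 st] /andP[s'0 s't].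
have sW' := sW m s'0; move: sW'.
have [c [p [/(_ s0) pE -> fE]]] := WE s n.
have [c' [p' [/(_ s'0) pE' -> fE']]] := WE s' m => sW'.
under eq_Rintegral do rewrite fE fE'.
rewrite step_sum_inner; last 2 first.
- by move=> i; have /andP[-> /le_trans ->] := pE i.
- by move=> i; have /andP[-> /le_trans ->] := pE' i.
have p0 i : 0 <= p i by case/andP: (pE i).
have p0' i : 0 <= p' i by case/andP: (pE' i).
rewrite inner_suml//; last by move=> i; apply: square_integrableZ; exact: sB.
apply: eq_bigr => i _; rewrite innerZl//; last exact: sB.
rewrite innerC inner_suml; [|by move=> j; apply: square_integrableZ; exact: sB|exact: sB].
rewrite mulr_sumr; apply: eq_bigr => j _; rewrite innerZl; [|exact: sB|exact: sB].
by rewrite (brownian_covariance fF bB)// minC mulrA.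
Qed.

Let mf s n : measurable_fun setT (f s n) := measurable_wiener_sum_below rho s n.

Let itv_fin (a b : R) : (mu `[a, b]%classic < +oo)%E.
Proof. by rewrite lebesgue_measure_itv/=; case: ifP => _; rewrite ?ltry// -EFinD ltry. Qed.

Let bounded_integrable (t M : R) (h : R -> R) : measurable_fun setT h ->
  (forall x, 0 <= x -> `|h x| <= M) -> mu.-integrable `[0, t] (EFin \o h).
Proof.
move=> mh hM; apply: measurable_bounded_integrable => //.
- exact: itv_fin.
- exact: measurable_funTS.
- exists M; split; first exact: num_real.
  by move=> y My x /=; rewrite in_itv/= => /andP[x0 _]; rewrite (le_trans (hM x x0))// ltW.
Qed.

Let W_cauchy s : 0 < s -> forall e, 0 < e -> exists N, forall n m,
  (N <= n)%N -> (N <= m)%N -> inner P (W s n \- W s m) (W s n \- W s m) <= e.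
Proof.
move=> s0 e e0.
have [M HM] := wiener_sum_below_bounded crho s0.
have M0 : 0 <= M by rewrite (le_trans _ (HM 0%N 0)).
have [M' HM'] := wiener_kernel_bounded cr s.
have mk := measurable_wiener_kernel cr s.
have [_ E0 _] := @dominated_convergence_R R `[0, s]%classic (f s) (wiener_kernel r s) M
  (measurable_itv _) (itv_fin _ _) (fun n => measurable_funTS (mf s n)) (measurable_funTS mk)
  (aeW _ (fun x x0s => wiener_sum_below_cvg crho cr r0 dr s0 (proj1 (andP x0s))))
  (fun n x _ => HM n x).
(* By the isometry the squared distance is the integral of [(f s n - f s m) ^ 2]. One factor is at
   most [2 * M], so convergence of [f s n] in L^1 suffices: two errors of this size give at most
   [4 * M * e / (4 * M + 1) <= e]. The added 1 covers [M = 0]. *)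
have eM : 0 < e / (4 * M + 1) by rewrite divr_gt0//; lra.
have [N _ HN] := (cvgr0Pnorm_lt _).1 E0 _ eM.
exists N => n m Nn Nm.
have s0s : 0 <= s <= s by rewrite (ltW s0) lexx.
have sn := sW n (ltW s0); have sm := sW m (ltW s0).
rewrite inner_subsqr// !(wiener_sum_isometry _ _ s0s s0s).
have ifn i : mu.-integrable `[0, s] (EFin \o f s i).
  exact: (@bounded_integrable _ M _ (mf s i) (fun x _ => HM i x)).
have iff i j : mu.-integrable `[0, s] (EFin \o (fun x => f s i x * f s j x)).
  apply: (@bounded_integrable _ (M * M)); first exact: measurable_funM.
  by move=> x _; rewrite normrM ler_pM// HM.
have ik : mu.-integrable `[0, s] (EFin \o wiener_kernel r s).
  exact: (@bounded_integrable _ M').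
have idk i : mu.-integrable `[0, s] (EFin \o (fun x => `|f s i x - wiener_kernel r s x|)).
  apply: (@bounded_integrable _ (M + M')).
    by apply: measurableT_comp => //; exact: measurable_funB.
  by move=> x x0; rewrite normr_id (le_trans (ler_normB _ _))// lerD// ?HM// HM'.
have -> : \int[mu]_(x in `[0, s]) (f s n x * f s n x) -
    2 * \int[mu]_(x in `[0, s]) (f s n x * f s m x) +
    \int[mu]_(x in `[0, s]) (f s m x * f s m x) =
    \int[mu]_(x in `[0, s]) ((f s n x - f s m x) ^+ 2).
  rewrite -RintegralZl// -RintegralB//; last exact: (integrableZl _ 2 (iff n m)).
  rewrite -RintegralD//; last exact: (integrableB _ (iff n n) (integrableZl _ 2 (iff n m))).
  by apply: eq_Rintegral => x _; ring.
apply: (@le_trans _ _ (2 * M * (\int[mu]_(x in `[0, s]) `|f s n x - wiener_kernel r s x| +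
   \int[mu]_(x in `[0, s]) `|f s m x - wiener_kernel r s x|))).
  rewrite -RintegralD// -RintegralZl//; last exact: (integrableD _ (idk n) (idk m)).
  apply: le_Rintegral => //.
  - apply: (@bounded_integrable _ ((M + M) ^+ 2)).
      by apply: measurable_funX; exact: measurable_funB.
    by move=> x _; rewrite normrX lerXn2r ?nnegrE ?addr_ge0// (le_trans (ler_normB _ _))// lerD// HM.
  - exact: (integrableZl _ (2 * M) (integrableD _ (idk n) (idk m))).
  - move=> x _; rewrite -(real_normK (num_real (_ - _))) expr2 ler_pM//.
      by rewrite (le_trans (ler_normB _ _))// mulrDl mul1r lerD// HM.
    by rewrite [X in _ <= _ + X]distrC (le_trans _ (ler_normD _ _))// addrA subrK.
have Hn := le_lt_trans (ler_norm _) (HN n Nn); have Hm := le_lt_trans (ler_norm _) (HN m Nm).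
rewrite (@le_trans _ _ (2 * M * (e / (4 * M + 1) + e / (4 * M + 1))))//.
  by apply: ler_wpM2l; [rewrite mulr_ge0|apply: lerD; exact: ltW].
rewrite -mulrDl mulrA ler_pdivrMr; last by lra.
nra.
Qed.

Variable J : R -> T -> R.
Hypothesis mJ : forall s, 0 < s -> measurable_fun setT (J s).
Hypothesis WJ : forall s, 0 < s -> {ae P, forall w, W s ^~ w @ \oo --> J s w}.

Let W_cvg s : 0 < s -> square_integrable P (J s) /\
  inner P (W s n \- J s) (W s n \- J s) @[n --> \oo] --> (0 : R).
Proof.
move=> s0; apply: mean_square_limit.
- by move=> n; exact: sW (ltW s0).
- exact: mJ.
- exact: WJ.
- exact: W_cauchy.
Qed.

Lemma wiener_integral_square_integrable s : 0 < s -> square_integrable P (J s).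
Proof. by case/W_cvg. Qed.

(** Applied with the constant 1 this gives mean zero; with [X0] it gives the vanishing of the cross
    terms in the covariance. *)
Lemma wiener_integral_orthogonal s g : 0 < s -> square_integrable P g ->
  (forall t, 0 <= t -> inner P (B t) g = 0) -> inner P (J s) g = 0.
Proof.
move=> s0 sg Bg; have [sJ cJ] := W_cvg s0.
have g0 : inner P (g \- g) (g \- g) @[n --> \oo] --> (0 : R).
  rewrite (_ : inner _ _ _ = 0); first exact: cvg_cst.
  by rewrite inner_subsqr//; ring.
have := inner_mean_square_cvg (fun n => sW n (ltW s0)) sJ (fun _ => sg) sg cJ g0.
rewrite (_ : (fun n => _) = (fun=> 0)); last first.
  by apply/funext => n; rewrite inner_W// ltW.
by move=> H; apply/esym; apply: (cvg_unique _ _ H) => //; exact: cvg_cst.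
Qed.

Lemma wiener_integral_isometry t s s' : 0 < s <= t -> 0 < s' <= t ->
  inner P (J s) (J s') =
  \int[mu]_(x in `[0, t]) (wiener_kernel r s x * wiener_kernel r s' x).
Proof.
move=> /andP[s0 st] /andP[s'0 s't].
have [sJ cJ] := W_cvg s0; have [sJ' cJ'] := W_cvg s'0.
have H := inner_mean_square_cvg (fun n => sW n (ltW s0)) sJ (fun n => sW n (ltW s'0)) sJ' cJ cJ'.
have [M HM] := wiener_sum_below_bounded crho s0.
have [M' HM'] := wiener_sum_below_bounded crho s'0.
apply: (cvg_unique _ H) => //.
rewrite (_ : (fun n => _) = (fun n => \int[mu]_(x in `[0, t]) (f s n x * f s' n x))); last first.
  by apply/funext => n; apply: wiener_sum_isometry; rewrite ltW.
pose F_ n x := f s n x * f s' n x.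
pose K x := wiener_kernel r s x * wiener_kernel r s' x.
have mF_ n : measurable_fun `[0, t]%classic (F_ n).
  by apply: measurable_funTS; exact: measurable_funM.
have mK : measurable_fun `[0, t]%classic K.
  by apply: measurable_funTS; apply: measurable_funM; exact: measurable_wiener_kernel.
have FK : {ae mu, forall x, `[0, t]%classic x -> F_ ^~ x @ \oo --> K x}.
  apply: aeW => x /=; rewrite in_itv/= => /andP[x0 _].
  by apply: cvgM; exact: (wiener_sum_below_cvg crho cr r0 dr).
have FM n x : `[0, t]%classic x -> `|F_ n x| <= M * M'.
  by move=> _; rewrite normrM ler_pM ?HM ?HM'.
by have [_ _] := dominated_convergence_R (measurable_itv _) (itv_fin _ _) mF_ mK FK FM.
Qed.

End wiener_integral.

(** * The asymptotic autocovariance *)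

Section even_extension.
Context {R : realType}.
Notation mu := (@lebesgue_measure R).

Lemma continuous_comp_norm (f : R -> R) :
  {within `[0, +oo[%classic, continuous f} -> continuous (fun x : R => f `|x|).
Proof.
move=> /subspace_continuousP cf x.
have x0 : `[0, +oo[%classic `|x| by rewrite /= in_itv/= andbT.
apply: (cvg_comp _ _ _ (cf _ x0)).
move=> A /= [e /= e0 eA].
have /cvgrPdist_lt /(_ _ e0) : (fun y : R => `|y|) @ x --> `|x| by exact: norm_continuous.
apply: filterS => y xy; apply: eA => //=.
by rewrite in_itv/= andbT.
Qed.

Lemma integral_translation (g : R -> R) (t : R) : continuous g -> (forall x, 0 <= g x) ->
  (\int[mu]_(x in `[t, +oo[) (g x)%:E = \int[mu]_(x in `[0%R, +oo[) (g (x + t))%:E)%E.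
Proof.
move=> cg g0.
have dE (x : R) : is_derive x (1 : R) (fun x : R => x + t) 1.
  by apply: is_derive_eq; rewrite addr0.
have F' : ((fun x : R => x + t)^`() = cst 1)%classic.
  by apply/funext => x; rewrite derive1E; exact: derive_val.
have ct : continuous (fun x : R => x + t).
  by move=> x; apply: cvgD; [exact: cvg_id|exact: cvg_cst].
have := @increasing_ge0_integration_by_substitutiony R (fun x => x + t) g 0.
rewrite add0r => -> //.
- by apply: eq_integral => x _; rewrite F'/= mulr1.
- by move=> x y _ _ xy; rewrite ltrD2r.
- by rewrite F' => x _; exact: cst_continuous.
- by rewrite F'; exact: is_cvg_cst.
- by rewrite F'; exact: is_cvg_cst.
- split; first by move=> x _; exact: ex_derive.
  by apply: cvg_at_right_filter; exact: ct.
- exact: cvg_addrr.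
- exact: continuous_subspaceT.
Qed.

(** Dominated by [g s ^ 2 + g (s + t) ^ 2]; the shifted square is integrable because its integral is
    that of [g ^ 2] over [t, +oo[. *)
Lemma autocorrelation_integrable (g : R -> R) (t : R) : 0 <= t -> continuous g ->
  mu.-integrable `[0, +oo[ (fun s => (g s ^+ 2)%:E) ->
  mu.-integrable `[0, +oo[ (EFin \o (fun s => g s * g (s + t))).
Proof.
move=> t0 cg ig.
have ct : continuous (fun x : R => x + t).
  by move=> x; apply: cvgD; [exact: cvg_id|exact: cvg_cst].
have cg2 : continuous (fun x => g x ^+ 2).
  by move=> x; under eq_fun do rewrite expr2; exact: continuous_mulR.
have mcont (h : R -> R) : continuous h -> measurable_fun (`[0%R, +oo[%classic : set R) h.
  by move=> ch; apply: measurable_funTS; exact: continuous_measurable_fun.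
have igt : mu.-integrable `[0, +oo[ (EFin \o (fun s => g (s + t) ^+ 2)).
  apply/integrableP; split.
    by apply/measurable_EFinP; apply: mcont; exact: (continuous_compR cg2 ct).
  under eq_integral do rewrite /= ger0_norm ?sqr_ge0//.
  rewrite -(@integral_translation (fun x => g x ^+ 2))//; last by move=> x; exact: sqr_ge0.
  case/integrableP: ig => _; apply: le_lt_trans.
  under [leRHS]eq_integral do rewrite /= ger0_norm ?sqr_ge0//.
  apply: ge0_subset_integral => //.
  - by apply/measurable_EFinP; exact: mcont.
  - by move=> x _; rewrite lee_fin sqr_ge0.
  - by move=> x /=; rewrite !in_itv/= !andbT; exact: le_trans.
apply: (le_integrable _ _ _ (integrableD _ ig igt)) => //.
  apply/measurable_EFinP; apply: mcont; apply: continuous_mulR => //.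
  exact: (continuous_compR cg ct).
move=> x _ /=; rewrite lee_fin [X in _ <= X]ger0_norm ?addr_ge0 ?sqr_ge0//.
rewrite normrM -(real_normK (num_real (g x))) -(real_normK (num_real (g (x + t)))).
have := sqr_ge0 (`|g x| - `|g (x + t)|); have := normr_ge0 (g x); have := normr_ge0 (g (x + t)).
nra.
Qed.

End even_extension.

Unset Implicit Arguments. Set Strict Implicit. Set Printing Implicit Defensive.

Theorem mainTheorem1 (R : realType) (d : measure_display) (T : measurableType d)
  (P : probability T R) (F : R -> set (set T)) (B : R -> T -> R)
  (X0 : T -> R) (X : R -> T -> R) (a sig : R) (k r : R -> R) :
  lebesgue_measure.-integrable `[0, +oo[%classic (EFin \o k) ->
  {within `[0, +oo[%classic, continuous k} ->
  sig != 0 ->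
  resolvent a k r ->
  lebesgue_measure.-integrable `[0, +oo[%classic (fun s => (r s ^+ 2)%:E) ->
  filtration F ->
  brownian_motion P F B ->
  measurable_wrt (F 0) X0 ->
  (\int[P]_w ((X0 w) ^+ 2)%:E < +oo)%E ->
  indep_rv_process P X0 B ->
  (forall t, 0 <= t -> measurable_wrt (F t) (X t)) ->
  {ae P, forall w,
     {within `[0, +oo[%classic, continuous (fun t => X t w)} /\
     (forall t, 0 <= t ->
        X t w = X0 w
          + \int[lebesgue_measure]_(u in `[0, t])
              (a * X u w + \int[lebesgue_measure]_(s in `[0, u]) (k (u - s) * X s w))
          + sig * B t w)} ->
  forall t, 0 <= t ->
    covariance P (X s) (X (s + t)) @[s --> +oo] -->
      ((sig ^+ 2 * \int[lebesgue_measure]_(s in `[0, +oo[) (r s * r (s + t)))%:E)%E.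
Proof.
move=> ik ck sig0 [r0 crw dr0 _] ir2 fF bB mX0 X02 ind adX Xeq t t0.
(* Even extensions: continuous everywhere and equal to [k] and [r] wherever the equation evaluates
   them. *)
pose K (x : R) := k `|x|; pose rr (x : R) := r `|x|.
have cK : continuous K by exact: continuous_comp_norm.
have cr : continuous rr by exact: continuous_comp_norm.
have rrE s : 0 <= s -> rr s = r s by move=> s0; rewrite /rr ger0_norm.
pose rho s := a * rr s + convol K rr s.
have crho : continuous rho by exact: resolvent_slope_continuous.
have rr0 : rr 0 = 1 by rewrite rrE.
have dr (s : R) : 0 < s -> is_derive s (1 : R) rr (rho s).
  move=> s0; rewrite /rho convolE ?(ltW s0)// rrE ?(ltW s0)//.
  rewrite (_ : Rintegral _ _ _ =
      \int[lebesgue_measure]_(u in `[0, s]) (k (s - u) * r u)); last first.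
    apply: eq_Rintegral => u; rewrite inE/= in_itv/= => /andP[u0 us].
    by rewrite rrE// /K ger0_norm// subr_ge0.
  apply: near_eq_is_derive (dr0 s s0); near=> u; rewrite rrE//.
  by apply: ltW; near: u; exact: lt_nbhsr.
have ir2' : lebesgue_measure.-integrable `[0, +oo[ (fun s => (rr s ^+ 2)%:E).
  apply: eq_integrable ir2 => // s; rewrite inE/= in_itv/= andbT => s0.
  by rewrite rrE.
have rrcvg : rr s @[s --> +oo] --> (0 : R).
  apply: (@resolvent_cvg0 R a K rr cK cr (\int[lebesgue_measure]_(x in `[0, +oo[) `|k x|)) => // s s0.
  rewrite (_ : Rintegral _ _ _ = \int[lebesgue_measure]_(x in `[0, s]) `|k x|); last first.
    apply: eq_Rintegral => u; rewrite inE/= in_itv/= => /andP[u0 _].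
    by rewrite /K (ger0_norm u0).
  have ikn := integrable_norm ik.
  have sub : (`[0, s]%classic : set R) `<=` `[0, +oo[%classic.
    by move=> x /=; rewrite !in_itv/= => /andP[->].
  have iks : lebesgue_measure.-integrable `[0, s] (EFin \o (Num.norm \o k)).
    by apply: (@integrableS _ _ _ lebesgue_measure `[0, +oo[%classic `[0, s]%classic).
  rewrite /Rintegral fine_le//.
  - exact: (integrable_fin_num _ iks).
  - exact: (integrable_fin_num _ ikn).
  - by apply: ge0_subset_integral => //; case/integrableP: ikn.
have mX s : 0 <= s -> measurable_fun setT (X s).
  by move=> s0; exact: (adapted_measurable fF s0 (adX s s0)).
have mX0' : measurable_fun setT X0 by exact: (adapted_measurable fF (lexx 0) mX0).
have sX0 : square_integrable P X0.
  split => //; apply/integrableP; split.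
    by apply/measurable_EFinP; exact: measurable_funX.
  by under eq_integral do rewrite /= ger0_norm ?sqr_ge0//.
(* With this definition the decomposition of [X] holds at every [w], while the equation for [X] is
   needed only almost everywhere, in [WJ]. Here [sig != 0] enters. *)
pose J s w := sig^-1 * (X s w - rr s * X0 w).
have mJ s : 0 < s -> measurable_fun setT (J s).
  move=> s0; apply: measurable_funM => //; apply: measurable_funB.
    by apply: mX; exact: ltW.
  exact: measurable_funM.
have WJ s : 0 < s ->
    {ae P, forall w, (fun n => wiener_sum rho s n (B ^~ w)) @ \oo --> J s w}.
  move=> s0; case: bB => _ _ cB _ _.
  apply: filterS2 cB Xeq => w cBw [cXw Xw].
  have cb : continuous (fun u : R => B `|u| w) by exact: (@continuous_comp_norm R (fun u => B u w)).
  have cx : continuous (fun u : R => X `|u| w) by exact: (@continuous_comp_norm R (fun u => X u w)).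
  have vE : forall t, 0 <= t -> X `|t| w = X0 w +
      \int[lebesgue_measure]_(u in `[0, t]) (a * X `|u| w + convol K (fun u : R => X `|u| w) u) +
      sig * B `|t| w.
    move=> v v0; rewrite ger0_norm// Xw//; congr (_ + _ + _).
    apply: eq_Rintegral => u; rewrite inE/= in_itv/= => /andP[u0 _].
    rewrite convolE// ger0_norm//; congr (_ + _).
    apply: eq_Rintegral => v'; rewrite inE/= in_itv/= => /andP[v'0 v'u].
    by rewrite /K !ger0_norm// subr_ge0.
  have := volterra_representation cK cr rr0 dr cx cb vE (ltW s0).
  rewrite ger0_norm ?(ltW s0)// -/rho => XE.
  have -> : J s w = B `|s| w + \int[lebesgue_measure]_(u in `[0, s]) (rho (s - u) * B `|u| w).
    by rewrite /J XE (addrC (rr s * _)) addrK mulKf// (ger0_norm (ltW s0)).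
  (* All nodes lie in [0, s], so extending the path evenly does not change the sums. *)
  rewrite (_ : (fun n => _) = fun n => wiener_sum rho s n (fun u : R => B `|u| w)); last first.
    apply/funext => n; have [c [p [/(_ (ltW s0)) pE wE]]] := wiener_sum_steps rho s n.
    by rewrite !wE; apply: eq_bigr => i _; rewrite ger0_norm//; case/andP: (pE i).
  apply: (@wiener_sum_cvg R rho crho s (fun u : R => B `|u| w) 0) => //.
  - exact: continuous_measurable_fun.
  - have [M _ HM] := bounded_on_segment 0 s cb.
    by exists M => u us; apply: HM; rewrite in_itv.
  - by move=> u _; exact: cb.
have sJ s : 0 < s -> square_integrable P (J s).
  move=> s0; exact: (wiener_integral_square_integrable fF bB crho cr rr0 dr mJ WJ s0).
have s1 : square_integrable P (cst 1) by exact: square_integrable_cst.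
have J1 s : 0 < s -> inner P (J s) (cst 1) = 0.
  move=> s0; apply: (wiener_integral_orthogonal fF bB crho cr rr0 dr mJ WJ s0 s1) => u u0.
  by case: (brownian_moments fF bB u0).
have J0 s : 0 < s -> inner P (J s) X0 = 0.
  move=> s0; apply: (wiener_integral_orthogonal fF bB crho cr rr0 dr mJ WJ s0 sX0) => u u0.
  by rewrite innerC (brownian_independent_inner fF bB).
pose V := inner P X0 X0 - inner P X0 (cst 1) ^+ 2.
pose C s := rr s * rr (s + t) * V +
  sig ^+ 2 * \int[lebesgue_measure]_(x in `[0, s]) (rr x * rr (x + t)).
have JJ s : 0 < s -> inner P (J s) (J (s + t)) =
    \int[lebesgue_measure]_(x in `[0, s]) (rr x * rr (x + t)).
  move=> s0.
  have ss : 0 < s <= s + t by rewrite s0 lerDl.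
  have ts : 0 < s + t <= s + t by rewrite lexx ltr_wpDr.
  rewrite (wiener_integral_isometry fF bB crho cr rr0 dr mJ WJ ss ts).
  (* The product of the kernels at [s] and [s + t] is [g (s - x)] for [x < s] and 0 afterwards;
     reflecting [0, s] turns its integral into that of [g]. The end point [s] is dropped first, the
     cutoff in the kernel being strict. *)
  pose g (x : R) := rr x * rr (x + t).
  have cg : continuous g.
    apply: continuous_mulR => //; apply: continuous_compR => // x.
    by apply: cvgD; [exact: cvg_id|exact: cvg_cst].
  rewrite -(Rintegral_reflect (ltW s0) cg) -[RHS]Rintegral_itv_bndo_bndc; last first.
    have cgs : continuous (fun x => g (s - x)).
      by apply: continuous_compR => //; exact: continuous_subl.
    apply: (@integrableS _ _ _ lebesgue_measure `[0, s]%classic `[0, s[%classic) => //.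
      exact: subset_itv_co_cc.
    exact: continuous_integrable.
  rewrite (_ : `[0, s[%classic = `[0, s + t]%classic `&` `]-oo, s[%classic); last first.
    apply/seteqP; split => x /=; rewrite !in_itv/=.
      by move=> /andP[x0 xs]; rewrite x0 xs (le_trans (ltW xs))// lerDl.
    by move=> [/andP[-> _] ->].
  rewrite Rintegral_mkcondr; apply: eq_Rintegral => x.
  rewrite inE/= in_itv/= => /andP[x0 xst].
  rewrite patchE mem_setE in_itv/= /wiener_kernel /below /g.
  have [xs|_] := ltP x s; last by rewrite !mul0r.
  rewrite mul1r addrAC; case: ltP xst => [_ _|xst1 xst2]; first by rewrite mul1r.
  by move: xs; rewrite ltNge (le_trans _ xst1)// lerDl.
have XE v : X v = (fun w => rr v * X0 w + sig * J v w).
  by apply/funext => w; rewrite /J mulVKf// subrKC.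
have sZ c f := @square_integrableZ _ _ _ P c f.
have innerXl u f : 0 < u -> square_integrable P f -> inner P (X u) f =
    rr u * inner P X0 f + sig * inner P (J u) f.
  move=> u0 sf; have su := sJ u u0.
  rewrite (XE u) (innerDl (sZ (rr u) _ sX0) (sZ sig _ su) sf).
  by rewrite (innerZl _ sX0 sf) (innerZl _ su sf).
have sX u : 0 < u -> square_integrable P (X u).
  by move=> u0; rewrite XE; apply: square_integrableD; apply: sZ => //; exact: sJ.
have innerXX u v : 0 < u -> 0 < v -> inner P (X u) (X v) =
    rr u * rr v * inner P X0 X0 + sig ^+ 2 * inner P (J u) (J v).
  move=> u0 v0; have [su sv] := (sJ u u0, sJ v v0).
  rewrite innerXl//; last exact: sX.
  rewrite (innerC P X0) (innerC P (J u)) !innerXl// (innerC P X0 (J u)) !J0//.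
  by rewrite (innerC P (J v)); ring.
have innerX1 u : 0 < u -> inner P (X u) (cst 1) = rr u * inner P X0 (cst 1).
  by move=> u0; rewrite innerXl// J1// mulr0 addr0.
have covE s : 0 < s -> covariance P (X s) (X (s + t)) = (C s)%:E.
  move=> s0; have st0 : 0 < s + t by rewrite ltr_wpDr.
  rewrite covariance_inner; [|exact: sX|exact: sX].
  by rewrite innerXX// !innerX1// JJ// /C /V; congr EFin; ring.
(* The covariance is extended-real and its formula was proved for [s > 0]; knowing it near infinity
   is enough to pass to a real limit. *)
have covnear : \forall s \near +oo, covariance P (X s) (X (s + t)) = (C s)%:E.
  by near=> s; apply: covE; near: s; exact: nbhs_pinfty_gt.
apply/fine_cvgP; split; first by apply: filterS covnear => s ->.
suff CL : C s @[s --> +oo] --> sig ^+ 2 *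
    \int[lebesgue_measure]_(s in `[0, +oo[) (r s * r (s + t)).
  apply: cvg_trans CL; apply: near_eq_cvg.
  by apply: filterS covnear => s /= ->.
rewrite (_ : _ * _ = 0 * 0 * V + sig ^+ 2 *
    \int[lebesgue_measure]_(s in `[0, +oo[) (rr s * rr (s + t))); last first.
  rewrite !mul0r add0r; congr (_ * _).
  apply: eq_Rintegral => s; rewrite inE/= in_itv/= andbT => s0.
  by rewrite !rrE// addr_ge0.
(* The contribution of the variance [V] of [X0] dies out because [rr] tends to 0 along both [s] and
   [s + t]; the remaining integral converges by integrability of the autocorrelation. *)
apply: cvgD; apply: cvgM; [|exact: cvg_cst|exact: cvg_cst|].
  apply: cvgM => //; apply: (cvg_comp (fun s => s + t) rr _ rrcvg); exact: cvg_addrr.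
by apply: cvg_Rintegral_0y; exact: autocorrelation_integrable.
Unshelve. all: by end_near. Qed.
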